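(* Let $\mathcal{P}$ be the class of all $4$-critical planar graphs and let $$L \coloneqq \limsup_{G\in\mathcal{P},\ |V(G)|\to\infty} \frac{|E(G)|}{|V(G)|} = \inf_{N\ge 1}\ \sup\left\{\frac{|E(G)|}{|V(G)|} : G\in \mathcal{P},\ |V(G)|\ge N\right\}.$$ Then $L = 2.5$.
   Context: All graphs are finite and simple. A (proper) $k$-coloring of a graph $G=(V,E)$ is a function $f:V\to\{1,\dots,k\}$ such that $f(u)\neq f(v)$ whenever $uv\in E$. The chromatic number $\chi(G)$ is the smallest $k$ such that $G$ has a $k$-coloring. A graph $G=(V,E)$ is $k$-critical if $\chi(G-e)<\chi(G)=k$ for every edge $e\in E$, where $G-e$ denotes the graph obtained by deleting the edge $e$. *)

(* Defs.v *)
From HB Require Import structures.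
From mathcomp Require Import all_boot all_order all_algebra.
From mathcomp Require Import all_classical all_reals all_analysis.

Set Implicit Arguments.
Unset Strict Implicit.
Unset Printing Implicit Defensive.

Import Order.TTheory GRing.Theory Num.Theory.
Import numFieldNormedType.Exports.

Local Open Scope classical_set_scope.
Local Open Scope ring_scope.

Record sgraph := SGraph {
  vertex :> finType;
  adj : rel vertex;
  adj_sym : symmetric adj;
  adj_irr : irreflexive adj }.

Definition edges (G : sgraph) : {set {set G}} :=
  [set [set xy.1; xy.2]%SET | xy in [pred xy : G * G | adj xy.1 xy.2]]%SET.

Definition is_coloring (G : sgraph) (k : nat) (f : G -> 'I_k) : bool :=
  [forall x : G, forall y : G, adj x y ==> (f x != f y)].

Definition colorable (G : sgraph) (k : nat) : bool :=
  [exists f : {ffun G -> 'I_k}, is_coloring f].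

Lemma colorable_card (G : sgraph) : exists k, colorable G k.
Proof.
exists #|G|; apply/existsP; exists [ffun x => enum_rank x].
apply/forallP => x; apply/forallP => y; apply/implyP => xy.
rewrite !ffunE (inj_eq enum_rank_inj).
by apply: contraTneq xy => ->; rewrite adj_irr.
Qed.

Definition chromatic_number (G : sgraph) : nat := ex_minn (colorable_card G).

Section DelEdge.
Variables (G : sgraph) (e : {set G}).

Definition del_adj : rel G :=
  fun x y => adj x y && ([set x; y]%SET != e).

Lemma del_adj_sym : symmetric del_adj.
Proof. by move=> x y; rewrite /del_adj adj_sym finset.setUC. Qed.

Lemma del_adj_irr : irreflexive del_adj.
Proof. by move=> x; rewrite /del_adj adj_irr. Qed.

Definition del_edge : sgraph := SGraph del_adj_sym del_adj_irr.
End DelEdge.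

Definition critical (k : nat) (G : sgraph) : Prop :=
  chromatic_number G = k /\
  forall e : {set G}, e \in edges G ->
    (chromatic_number (del_edge e) < chromatic_number G)%N.

(* A drawing of G in the plane R * R: the vertex x is placed at p x, and the
   edge e is drawn as the simple arc parametrised by c e on [0, 1].  The values
   of c e outside [0, 1], and of c on sets that are not edges, are irrelevant. *)
Definition plane_drawing (R : realType) (G : sgraph)
    (p : G -> R * R) (c : {set G} -> R -> R * R) : Prop :=
  [/\ injective p,
      forall e, e \in edges G ->
        [/\ {within `[0, 1], continuous (c e)},
            {in `[0, 1] &, injective (c e)}
          & [set c e 0; c e 1] = p @` [set x | x \in e]],
      forall e, e \in edges G ->
        forall t : R, t \in `]0, 1[ -> forall x, c e t <> p x
    & forall e e', e \in edges G -> e' \in edges G -> e <> e' ->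
        forall t t' : R, t \in `]0, 1[ -> t' \in `[0, 1] -> c e t <> c e' t'].

Definition planar (R : realType) (G : sgraph) : Prop :=
  exists (p : G -> R * R) (c : {set G} -> R -> R * R), plane_drawing p c.

Definition planar4critical (R : realType) (G : sgraph) : Prop :=
  critical 4 G /\ planar R G.

Definition density (R : realType) (G : sgraph) : R := #|edges G|%:R / #|G|%:R.

(* Infimum and supremum are taken in the extended reals, so that no boundedness
   or nonemptiness is presupposed.  The class P is a plain predicate because
   sgraph is too large a type to be the carrier of a classical set. *)
Definition limsup_density (R : realType) (P : sgraph -> Prop) : \bar R :=
  ereal_inf [set ereal_sup [set r | exists G : sgraph,
                [/\ P G, (N <= #|G|)%N & r = (density R G)%:E]]
            | N in [set N | (1 <= N)%N]].

(* Main.v *)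
(* Upper bound.  A plane drawing, restricted to a fine grid, exhibits [G] as a
   minor of the grid: the branch set of a vertex consists of the grid points
   near it and near suitable parts of its edges.  The unit squares, merged
   across all grid edges that are neither inside a branch set nor represent an
   edge of [G], are the faces; their boundaries span the cycle space of [G]
   over F_2 and every edge lies on at most two of them (MacLane's criterion), so
   some [r >= |E| - |V|] of them are independent.  If [t] of these are
   triangles, then [4 r - t <= 2 |E|].  Finally [t <= |V|], because in a
   4-critical graph the vertex sets of these triangles are linearly independent
   over Q; hence [|E| <= 5/2 |V|].

   Lower bound.  Take vertices [x_ij] and [y_ij] with [x_ij] adjacent to
   [x_(i+1)j] and [y_ij] adjacent to the four vertices [x_kl] with [k] in
   [{i, i+1}] and [l] in [{j, j+1}]; in a plane drawing the [y_ij] are centres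
   of the cells, and there are 5 edges for every 2 vertices.  In a 3-colouring the
   colour of [y_ij] depends on [i] only, and as soon as two columns [y_i] differ
   (a vertical wall), all rows of the [x_ij] are coloured alike (there is no
   horizontal wall).  Two long edges force a vertical and a horizontal wall, so
   there is no 3-colouring, but after the deletion of any edge away from the
   boundary the two walls can cross there.  A minimal subgraph that is not
   3-colourable is 4-critical and retains all these edges. *)
Require Import Defs.
From mathcomp Require Import all_boot all_order all_algebra.
From mathcomp Require Import all_classical all_reals all_analysis.
From mathcomp Require Import ring lra zify.
Import Order.TTheory GRing.Theory Num.Theory.
Import numFieldNormedType.Exports.

Set Implicit Arguments.
Unset Strict Implicit.
Unset Printing Implicit Defensive.

(** * Colourings, criticality and subgraphs *)

Lemma edgesP (G : sgraph) (e : {set G}) :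
  reflect (exists x y, adj x y /\ e = [set x; y]%SET) (e \in edges G).
Proof.
apply: (iffP imsetP) => [[[x y]] /=|[x [y [xy ->]]]].
  by rewrite inE /= => xy ->; exists x, y.
by exists (x, y).
Qed.

Lemma mem_edges (G : sgraph) (x y : G) : ([set x; y]%SET \in edges G) = adj x y.
Proof.
apply/edgesP/idP => [[a [b [ab]]]|xy]; last by exists x, y.
move=> h; have ne : a != b by apply: contraTneq ab => ->; rewrite adj_irr.
have : x \in [set a; b]%SET by rewrite -h !inE eqxx.
have : y \in [set a; b]%SET by rewrite -h !inE eqxx orbT.
rewrite !inE => /orP[] /eqP yE /orP[] /eqP xE; rewrite yE xE ?[adj b a]adj_sym //;
  move/setP: h; rewrite yE xE.
- by move=> /(_ b); rewrite !inE eqxx orbT orbb eq_sym (negbTE ne).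
- by move=> /(_ a); rewrite !inE eqxx orbb (negbTE ne).
Qed.

Lemma colorableP (G : sgraph) k :
  reflect (exists f : G -> 'I_k, forall x y, adj x y -> f x != f y)
          (colorable G k).
Proof.
apply: (iffP existsP) => [[f] /forallP h|[f h]].
  by exists f => x y xy; have /forallP/(_ y)/implyP := h x; apply.
exists [ffun x => f x]; apply/forallP => x; apply/forallP => y.
by apply/implyP => xy; rewrite !ffunE h.
Qed.

Lemma colorable_widen (G : sgraph) k l : (k <= l)%N -> colorable G k -> colorable G l.
Proof.
move=> kl /colorableP[f hf]; apply/colorableP.
exists (fun x => widen_ord kl (f x)) => x y /hf; apply: contra => /eqP h.
by apply/eqP/val_inj; move/(congr1 val): h.
Qed.

Lemma chromatic_number_leq (G : sgraph) k :
  (chromatic_number G <= k)%N = colorable G k.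
Proof.
rewrite /chromatic_number; case: ex_minnP => m cm hm; apply/idP/idP => [mk|/hm//].
exact: colorable_widen mk cm.
Qed.

Lemma critical4_nocolor (G : sgraph) : critical 4 G -> ~~ colorable G 3.
Proof. by case=> h _; rewrite -chromatic_number_leq h. Qed.

Lemma critical4_del_edge (G : sgraph) e : critical 4 G -> e \in edges G ->
  colorable (del_edge e) 3.
Proof. by case=> h h2 /h2; rewrite h ltnS chromatic_number_leq. Qed.

Lemma critical4I (G : sgraph) : ~~ colorable G 3 ->
  (forall e, e \in edges G -> colorable (del_edge e) 3) -> critical 4 G.
Proof.
move=> n3 h3.
suff c4 : chromatic_number G = 4.
  by split=> // e /h3; rewrite c4 ltnS chromatic_number_leq.
apply/eqP; rewrite eqn_leq chromatic_number_leq ltnNge chromatic_number_leq n3 andbT.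
have [|[e eG]] := set_0Vmem (edges G).
  move=> E0; case/negP: n3; apply/colorableP; exists (fun=> ord0) => x y.
  by rewrite -mem_edges E0 inE.
have /edgesP[u [v [uv eE]]] := eG; have /colorableP[f hf] := h3 _ eG.
apply/colorableP.
(* Four colours suffice: a 3-colouring of [G - e] becomes a 4-colouring of [G] once the end [u] of
   [e] receives the fourth colour. *)
exists (fun x => if x == u then ord_max else widen_ord (leqnSn 3) (f x)).
have neq (a : 'I_3) : widen_ord (leqnSn 3) a != ord_max.
  by apply/eqP => /(congr1 val) /= h; have := ltn_ord a; rewrite h ltnn.
move=> x y xy; case: (x =P u) => [xu|/eqP xu]; case: (y =P u) => [yu|/eqP yu] //.
- by move: xy; rewrite xu yu adj_irr.
- by rewrite eq_sym.
have : f x != f y.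
  apply: hf; rewrite /= /del_adj xy /=; apply: contraNneq xu => h.
  have : u \in [set x; y]%SET by rewrite h eE !inE eqxx.
  by rewrite !inE (eq_sym u x) (eq_sym u y) (negbTE yu) orbF.
by apply: contra => /eqP /(congr1 val) /= h; apply/eqP/val_inj.
Qed.

Section Subgraph.
Variables (G : sgraph) (E : {set {set G}}).

Definition sub_adj : rel G := fun x y => adj x y && ([set x; y]%SET \in E).

Lemma sub_adj_sym : symmetric sub_adj.
Proof. by move=> x y; rewrite /sub_adj adj_sym finset.setUC. Qed.

Lemma sub_adj_irr : irreflexive sub_adj.
Proof. by move=> x; rewrite /sub_adj adj_irr. Qed.

Definition subgraph : sgraph := SGraph sub_adj_sym sub_adj_irr.

Lemma edges_subgraph : edges subgraph = (edges G :&: E)%SET.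
Proof.
apply/setP => e; rewrite inE; apply/edgesP/andP => [[x [y [/andP[xy xyE] ->]]]|].
  by rewrite mem_edges xy.
by move=> [/edgesP[x [y [xy ->]]] xyE]; exists x, y; split=> //=; apply/andP.
Qed.

End Subgraph.

Lemma planar_subgraph (R : realType) (G : sgraph) (E : {set {set G}}) :
  planar R G -> planar R (subgraph E).
Proof.
move=> [p [c [h1 h2 h3 h4]]]; exists p, c.
have sub e : e \in edges (subgraph E) -> e \in edges G.
  by rewrite edges_subgraph inE => /andP[].
by split=> //; [move=> e /sub/h2|move=> e /sub/h3|move=> e e' /sub he /sub; exact: h4].
Qed.

(** Take [E] of minimal size such that the subgraph is not 3-colourable. If an edge [e] of [D] were
    missing from it, a 3-colouring of [G - e] would colour it. *)
Lemma critical_subgraph (G : sgraph) (D : {set {set G}}) :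
  ~~ colorable G 3 -> D \subset edges G ->
  (forall e, e \in D -> colorable (del_edge e) 3) ->
  exists E : {set {set G}}, D \subset edges (subgraph E) /\ critical 4 (subgraph E).
Proof.
move=> n3 DG hD.
pose P (E : {set {set G}}) := ~~ colorable (subgraph E) 3.
have PT : P (edges G).
  apply: contra n3 => /colorableP[f hf]; apply/colorableP; exists f => x y xy.
  by apply: hf; rewrite /= /sub_adj xy mem_edges xy.
case: (arg_minnP (fun E : {set {set G}} => #|E|) PT) => E PE minE.
exists E; split; last first.
  apply: critical4I => // e; rewrite edges_subgraph inE => /andP[eG eE].
  have : ~~ P (E :\ e)%SET.
    by apply/negP => /minE; rewrite (cardsD1 e E) eE add1n ltnn.
  rewrite negbK => /colorableP[f hf]; apply/colorableP; exists f => x y.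
  move=> /andP[/andP[xy xyE] ne]; apply: hf.
  by rewrite /= /sub_adj xy !inE ne.
apply/fintype.subsetP => e eD; rewrite edges_subgraph inE (fintype.subsetP DG) //=.
apply: contraR PE => eE; have /colorableP[f hf] := hD _ eD.
apply/colorableP; exists f => x y /andP[xy xyE]; apply: hf.
by rewrite /= /del_adj xy /=; apply: contraNneq eE => <-.
Qed.

(** * At most as many facial triangles as vertices *)

Definition is_triangle (G : sgraph) (C : {set {set G}}) : Prop :=
  exists u v w : G, [/\ adj u v, adj u w, adj v w &
    C = [set [set u; v]; [set u; w]; [set v; w]]%SET].

Lemma triangle_cover (G : sgraph) (u v w : G) :
  finset.cover [set [set u; v]; [set u; w]; [set v; w]]%SET = [set u; v; w]%SET.
Proof.
apply/setP => x; apply/finset.bigcupP/idP => [[e]|].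
  by rewrite !inE => /orP[/orP[]|] /eqP -> /[!inE] /orP[] /eqP ->; rewrite eqxx ?orbT.
rewrite !inE => /orP[/orP[]|] /eqP ->; [exists [set u; v]%SET|exists [set u; v]%SET|exists [set u; w]%SET];
  by rewrite !inE eqxx ?orbT.
Qed.

(** A triangle avoiding [e] is properly coloured, so each of the three colours occurs in it once. In
    a triangle through [e] both ends of [e] have the colour [f x] and the third vertex does not. *)
Lemma triangle_color_card (G : sgraph) (f : G -> 'I_3) (e : {set G}) (x y : G)
    (C : {set {set G}}) : e = [set x; y]%SET -> x != y -> f x = f y ->
  (forall u v, adj u v -> [set u; v]%SET != e -> f u != f v) ->
  is_triangle C ->
  #|[set z in finset.cover C | f z == f x]%SET| = (e \in C).+1.
Proof.
move=> eE xy fxy hf [u [v [w [uv uw vw ->]]]]; rewrite triangle_cover.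
have neq (a b : G) : adj a b -> a != b by move=> ab; apply: contraTneq ab => ->; rewrite adj_irr.
have := neq _ _ uv; have := neq _ _ uw; have := neq _ _ vw => nvw nuw nuv.
have card3 (a b c : G) (P : pred G) : a != b -> a != c -> b != c ->
    #|[set z in [set a; b; c] | P z]%SET| = (P a + P b + P c)%N.
  move=> ab ac bc.
  rewrite -sum1dep_card (eq_bigl (fun z => (z \in [:: a; b; c]) && P z)); last first.
    by move=> z; rewrite !inE orbA.
  rewrite big_mkcondr -big_uniq /=; last by rewrite !inE negb_or ab ac bc.
  by rewrite !big_cons big_nil addn0 addnA; case: (P a); case: (P b); case: (P c).
rewrite card3 // !inE.
case: (boolP (e == [set u; v]%SET)) => [/eqP e1|e1] /=.
- have [fu fv] : f u = f x /\ f v = f x.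
    have : u \in e by rewrite e1 !inE eqxx.
    have : v \in e by rewrite e1 !inE eqxx orbT.
    by rewrite eE !inE => /orP[] /eqP -> /orP[] /eqP ->.
  have : f u != f w.
    apply: hf => //; rewrite e1; apply: contraNneq nvw => h.
    have : v \in [set u; w]%SET by rewrite h !inE eqxx orbT.
    by rewrite !inE eq_sym (negbTE nuv).
  by rewrite fu fv eqxx eq_sym => /negbTE ->.
case: (boolP (e == [set u; w]%SET)) => [/eqP e2|e2] /=.
- have [fu fw] : f u = f x /\ f w = f x.
    have : u \in e by rewrite e2 !inE eqxx.
    have : w \in e by rewrite e2 !inE eqxx orbT.
    by rewrite eE !inE => /orP[] /eqP -> /orP[] /eqP ->.
  have : f u != f v by apply: hf => //; rewrite eq_sym.
  by rewrite fu fw eqxx eq_sym => /negbTE ->.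
have fuv : f u != f v by apply: hf => //; rewrite eq_sym.
have fuw : f u != f w by apply: hf => //; rewrite eq_sym.
case: (boolP (e == [set v; w]%SET)) => [/eqP e3|e3] /=.
- have [fv fw] : f v = f x /\ f w = f x.
    have : v \in e by rewrite e3 !inE eqxx.
    have : w \in e by rewrite e3 !inE eqxx orbT.
    by rewrite eE !inE => /orP[] /eqP -> /orP[] /eqP ->.
  by rewrite fv fw eqxx -fv (negbTE fuv).
have fvw : f v != f w by apply: hf => //; rewrite eq_sym.
move: fuv fuw fvw; rewrite -!(inj_eq val_inj).
by case: (f u) => [[|[|[|?]]] ?] //; case: (f v) => [[|[|[|?]]] ?] //;
   case: (f w) => [[|[|[|?]]] ?] //; case: (f x) => [[|[|[|?]]] ?].
Qed.

Lemma triangle_card (G : sgraph) (C : {set {set G}}) : is_triangle C -> #|finset.cover C| = 3.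
Proof.
move=> [u [v [w [uv uw vw ->]]]]; rewrite triangle_cover.
have neq (a b : G) : adj a b -> a != b by move=> ab; apply: contraTneq ab => ->; rewrite adj_irr.
by rewrite -finset.setUA cardsU1 !inE negb_or cards2 !neq.
Qed.

(* A relation [\sum_i a_i 1_(T i) = 0], summed over one colour class of a
   3-colouring of [G - e] and over all vertices, yields
   [\sum_(i | e \in T i) a_i = 0] for each edge [e]. *)
Lemma triangles_leq (G : sgraph) (t : nat) (T : 'I_t -> {set {set G}}) :
  critical 4 G -> (forall i, is_triangle (T i)) ->
  (forall e, (#|[set i | e \in T i]%SET| <= 2)%N) ->
  (forall S : {set 'I_t}, S != finset.set0 ->
     exists e, odd #|[set i in S | e \in T i]%SET|) ->
  (t <= #|G|)%N.
Proof.
move=> cG triT T2 indT.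
pose A := (\matrix_(i < t, x < #|G|) ((enum_val x \in finset.cover (T i))%:R : rat))%R.
(* The rows of [A] are the incidence vectors of the vertex sets; independent ones number at most
   [#|G|]. *)
suff fA : row_free A by move: fA; rewrite /row_free => /eqP <-; exact: rank_leq_col.
apply: inj_row_free => a aA0.
have col0 (x : G) : (\sum_i a 0 i * (x \in finset.cover (T i))%:R = 0)%R.
  move/rowP/(_ (enum_rank x)): aA0; rewrite !mxE => h; rewrite -[RHS]h.
  by apply: eq_bigr => i _; rewrite !mxE enum_rankK.
have sum0 (P : pred G) : (\sum_i a 0 i * (#|[set z in finset.cover (T i) | P z]%SET|)%:R = 0)%R.
  transitivity (\sum_(x | P x) \sum_i a 0 i * (x \in finset.cover (T i))%:R)%R; last first.
    by rewrite big1.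
  rewrite exchange_big; apply: eq_bigr => i _; rewrite -mulr_sumr; congr (_ * _)%R.
  rewrite -sum1dep_card natr_sum [RHS]big_mkcond [LHS]big_mkcond; apply: eq_bigr => z _.
  by case: (z \in _); case: (P z).
have edge0 e : (\sum_(i | e \in T i) a 0 i = 0)%R.
  have [eG|neG] := boolP (e \in edges G); last first.
    rewrite big1 // => i eT; case/negP: neG.
    have [u [v [w [uv uw vw E]]]] := triT i.
    by move: eT; rewrite E !inE => /orP[/orP[]|] /eqP ->; rewrite mem_edges.
  have /colorableP[f hf] := critical4_del_edge cG eG.
  have /edgesP[x [y [xy eE]]] := eG.
  have nxy : x != y by apply: contraTneq xy => ->; rewrite adj_irr.
  have hf' u v : adj u v -> [set u; v]%SET != e -> f u != f v.
    by move=> uv ne; apply: hf; rewrite /= /del_adj uv.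
  have fxy : f x = f y.
    apply/eqP; apply: contraNT (critical4_nocolor cG) => fxy.
    apply/colorableP; exists f => u v uv.
    have [E|/eqP ne] := [set u; v]%SET =P e; last exact: hf'.
    have : u \in [set x; y]%SET by rewrite -eE -E !inE eqxx.
    have : v \in [set x; y]%SET by rewrite -eE -E !inE eqxx orbT.
    by rewrite !inE => /orP[] /eqP vE /orP[] /eqP uE; move: uv;
      rewrite vE uE ?adj_irr // eq_sym.
  have h1 := sum0 xpredT; have h2 := sum0 (fun z => f z == f x).
  have k2 : (\sum_i a 0 i * ((e \in T i).+1)%:R = 0)%R.
    rewrite -[RHS]h2; apply: eq_bigr => i _; congr (_ * _%:R)%R.
    by rewrite (triangle_color_card eE).
  (* Each triangle has three vertices, so the count over all vertices is three times the sum of the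
     coefficients. *)
  have k1 : (\sum_i a 0 i = 0)%R.
    have : ((\sum_i a 0 i) * 3 = 0)%R.
      rewrite -[RHS]h1 mulr_suml; apply: eq_bigr => i _; congr (_ * _)%R.
      rewrite -(triangle_card (triT i)); congr (_%:R)%R; apply: eq_card => z.
      by rewrite !inE andbT.
    by move/eqP; rewrite mulf_eq0 orbF => /eqP.
  have : (\sum_i a 0 i * ((e \in T i).+1)%:R = \sum_i a 0 i + \sum_(i | e \in T i) a 0 i)%R.
    rewrite [X in (_ + X)%R]big_mkcond -big_split; apply: eq_bigr => i _ /=.
    by rewrite -natr1 mulrDr mulr1 addrC; case: (e \in T i); rewrite ?mulr1 ?mulr0.
  by rewrite k1 k2 add0r.
(* [S] is the support of the relation. If it is nonempty, some edge lies in an odd number of its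
   triangles, hence in exactly one, and [edge0] makes that coefficient zero. *)
pose S := [set i | a ord0 i != 0%R]%SET.
have [S0|/indT[e]] := eqVneq S finset.set0.
  apply/rowP => i; rewrite mxE; apply/eqP; apply: contraTT isT => ai.
  by move/setP/(_ i): S0; rewrite !inE ai.
suff [->|->] : #|[set i in S | e \in T i]%SET| = 0%N \/ #|[set i in S | e \in T i]%SET| = 2 by [].
have le2 : (#|[set i in S | e \in T i]%SET| <= 2)%N.
  apply: leq_trans (T2 e); apply: subset_leq_card; apply/fintype.subsetP => i.
  by rewrite !inE => /andP[].
have n1 : #|[set i in S | e \in T i]%SET| <> 1%N.
  move/eqP/cards1P => [i Si].
  have /[!inE]/andP[ai ei] : i \in [set i in S | e \in T i]%SET by rewrite Si inE.
  move: (edge0 e); rewrite (bigD1 i) //= big1 ?addr0; last first.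
    move=> k /andP[ek ki]; apply/eqP; apply: contraNT ki => ak.
    have : k \in [set i in S | e \in T i]%SET by rewrite !inE ak ek.
    by rewrite Si inE.
  by move/eqP; rewrite (negbTE ai).
by move: le2 n1; case: #|_| => [|[|[|]]] //; [left|right].
Qed.

(** * The edge bound from a 2-basis of the cycle space *)

(** These sets are the elements of the cycle space of [G] over F_2. *)
Definition even_set (G : sgraph) (Z : {set {set G}}) : Prop :=
  Z \subset edges G /\ forall v, ~~ odd #|[set e in Z | v \in e]%SET|.

Lemma edge_other_end (G : sgraph) (e : {set G}) (u : G) :
  e \in edges G -> u \in e -> exists w, adj u w /\ e = [set u; w]%SET.
Proof.
move=> /edgesP[x [y [xy ->]]]; rewrite !inE => /orP[] /eqP ->; first by exists y.
by exists x; rewrite adj_sym finset.setUC.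
Qed.

Lemma even_set_second (G : sgraph) (Z : {set {set G}}) (e : {set G}) (v : G) :
  even_set Z -> e \in Z -> v \in e -> exists e', [/\ e' \in Z, v \in e' & e' != e].
Proof.
move=> [_ /(_ v) evZ] eZ ve.
case: (set_0Vmem ([set e' in Z | v \in e'] :\ e)%SET) => [E0|[e']]; last first.
  by rewrite !inE => /and3P[ne eZ' ve']; exists e'.
by move: evZ; rewrite (cardsD1 e) E0 !inE eZ ve cards0.
Qed.

(** By evenness an edge of [Z] has a further edge of [Z] at each end, and in a simple graph these
    two are distinct. If [Z] contains nothing else, their far ends must coincide. *)
Lemma even_set_triangle (G : sgraph) (Z : {set {set G}}) :
  even_set Z -> Z != finset.set0 -> (3 <= #|Z|)%N /\ (#|Z| = 3 -> is_triangle Z).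
Proof.
move=> evZ /finset.set0Pn[e1 e1Z].
have sub e : e \in Z -> e \in edges G by apply/fintype.subsetP; case: evZ.
have /edgesP[u [v [uv e1E]]] := sub _ e1Z.
have ue1 : u \in e1 by rewrite e1E !inE eqxx.
have ve1 : v \in e1 by rewrite e1E !inE eqxx orbT.
have [e2 [e2Z ue2 ne2]] := even_set_second evZ e1Z ue1.
have [e3 [e3Z ve3 ne3]] := even_set_second evZ e1Z ve1.
have [w [uw e2E]] := edge_other_end (sub _ e2Z) ue2.
have [w' [vw' e3E]] := edge_other_end (sub _ e3Z) ve3.
have neq (a b : G) : adj a b -> a != b by move=> ab; apply: contraTneq ab => ->; rewrite adj_irr.
have wv : w != v by apply: contraNneq ne2 => wv; rewrite e2E e1E wv.
have n23 : e2 != e3.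
  apply/eqP => e23; have : v \in e2 by rewrite e23.
  by rewrite e2E !inE eq_sym (negbTE (neq _ _ uv)) eq_sym (negbTE wv).
have card3 : #|[set e1; e2; e3]%SET| = 3.
  by rewrite -finset.setUA cardsU1 !inE negb_or eq_sym ne2 eq_sym ne3 cards2 n23.
have sub3 : [set e1; e2; e3]%SET \subset Z.
  by apply/fintype.subsetP => e; rewrite !inE => /orP[/orP[]|] /eqP ->.
split; first by rewrite -card3 subset_leq_card.
move=> Z3; have ZE : [set e1; e2; e3]%SET = Z.
  by apply/eqP; rewrite eqEcard sub3 Z3 card3.
(* A second edge of [Z] at [w] exists by evenness; it is not [e1], which misses [w], so it is
   [e3]. *)
have we3 : w \in e3.
  have we2 : w \in e2 by rewrite e2E !inE eqxx orbT.
  have [e [eZ we ne]] := even_set_second evZ e2Z we2.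
  move: eZ; rewrite -ZE !inE (negbTE ne) orbF => /orP[] /eqP eE; last by rewrite -eE.
  by move: we; rewrite eE e1E !inE (negbTE wv) orbF eq_sym (negbTE (neq _ _ uw)).
have ww' : w = w' by move: we3; rewrite e3E !inE (negbTE wv) => /eqP.
exists u, v, w; split=> //; first by rewrite ww'.
by rewrite -ZE e1E e2E e3E ww'.
Qed.

Lemma natrF2_eq0 n : ((n%:R : 'F_2) == 0)%R = ~~ odd n.
Proof. by rewrite -(dvdn_pcharf (pchar_Fp (isT : prime 2))) dvdn2. Qed.

Lemma F2_neq0 (x : 'F_2) : x = ((x != 0)%:R)%R.
Proof. by apply/eqP; case: x => [[|[|]]]. Qed.

Lemma sum_F2_card (I : finType) (P Q : pred I) :
  (\sum_(i | P i) ((Q i)%:R : 'F_2) = (#|[set i | P i && Q i]%SET|)%:R)%R.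
Proof.
rewrite -sum1dep_card natr_sum big_mkcondr; apply: eq_bigr => i _.
by case: (Q i).
Qed.

Section TwoBasis.
Variables (G : sgraph) (F : finType) (C : F -> {set {set G}}).
Hypothesis evC : forall f, even_set (C f).
Hypothesis spanC : forall Z, even_set Z -> exists S : {set F},
  forall e, (e \in Z) = odd #|[set f in S | e \in C f]%SET|.

Let E := edges G.
Let B := (\matrix_(f < #|F|, e < #|E|) ((enum_val e \in C (enum_val f))%:R : 'F_2))%R.
Let inc := (\matrix_(e < #|E|, v < #|G|) ((enum_val v \in (enum_val e : {set G}))%:R : 'F_2))%R.

(** The left kernel of the incidence matrix [inc] is the cycle space, of dimension at least
    [#|E| - #|G|]; by [spanC] it lies in the row space of [B]. *)
Lemma two_basis_rank : (#|E| <= \rank B + #|G|)%N.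
Proof.
have : (kermx inc <= B)%MS.
  apply/rV_subP => a /sub_kermxP a0.
  pose Z := [set enum_val e | e : 'I_#|E| & a ord0 e != 0%R]%SET.
  have memZ (e : 'I_#|E|) : (enum_val e \in Z) = (a ord0 e != 0%R).
    by rewrite mem_imset ?inE //; exact: enum_val_inj.
  have evZ : even_set Z.
    split; first by apply/fintype.subsetP => e /imsetP[k _ ->]; exact: enum_valP.
    move=> v; rewrite -natrF2_eq0; move/rowP/(_ (enum_rank v)): a0; rewrite !mxE => a0.
    apply/eqP; rewrite -[RHS]a0; under eq_bigr do rewrite mxE enum_rankK.
    transitivity (\sum_(k : 'I_#|E|) ((((enum_val k : {set G}) \in Z) && (v \in (enum_val k : {set G})))%:R : 'F_2))%R.
      rewrite sum_F2_card; congr (_%:R)%R.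
      rewrite -(card_imset _ (@enum_val_inj _ (mem E))); apply: eq_card => e.
      rewrite inE; apply/andP/imsetP => [[eZ ve]|[k]]; last by rewrite inE => h ->; apply/andP.
      by move: (eZ) => /imsetP[k _ ek]; exists k => //; rewrite inE -ek eZ ve.
    apply: eq_bigr => k _; rewrite memZ {2}[a ord0 k]F2_neq0.
    by case: (a ord0 k != 0)%R; rewrite ?mul1r ?mul0r.
  have [S hS] := spanC evZ.
  apply/submxP; exists (\row_f ((enum_val f \in S)%:R : 'F_2))%R.
  apply/rowP => k; rewrite !mxE [LHS]F2_neq0 -memZ hS.
  under eq_bigr do rewrite !mxE -natrM mulnb.
  rewrite sum_F2_card.
  transitivity ((#|[set f in S | (enum_val k : {set G}) \in C f]%SET|)%:R : 'F_2)%R.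
    by rewrite [RHS]F2_neq0 natrF2_eq0 negbK.
  congr (_%:R)%R; rewrite -(card_imset _ (@enum_val_inj _ (mem F))); apply: eq_card => f.
  rewrite !inE; apply/idP/imsetP => [h|[i]]; last by rewrite !inE => h ->.
  by exists (enum_rank f); rewrite ?enum_rankK // !inE enum_rankK.
move=> /mxrankS; rewrite mxrank_ker leq_subLR addnC.
by move=> h; apply: leq_trans h _; rewrite leq_add2l rank_leq_col.
Qed.

Hypothesis C2 : forall e, (#|[set f | e \in C f]%SET| <= 2)%N.

Lemma two_basis_bound : critical 4 G -> (2 * #|E| <= 5 * #|G|)%N.
Proof.
move=> cG; have rk := two_basis_rank.
set r := \rank B in rk.
(* [g] selects [r] of the sets [C f] whose rows form a basis of the row space of [B]. *)
pose g : 'I_r -> F := fun i => enum_val (maxrankfun B i).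
have injg : injective g by move=> i j /enum_val_inj/maxrankfun_inj.
have indep (S : {set 'I_r}) : S != finset.set0 ->
    exists e, odd #|[set i in S | e \in C (g i)]%SET|.
  move=> /finset.set0Pn[i0 i0S].
  have [/existsP[k hk]|] := boolP [exists k : 'I_#|E|, odd #|[set i in S | (enum_val k : {set G}) \in C (g i)]%SET|].
    by exists (enum_val k).
  rewrite negb_exists => /forallP hS.
  pose y := (\row_(i < r) ((i \in S)%:R : 'F_2))%R.
  have : (y *m rowsub (maxrankfun B) B = 0)%R.
    apply/rowP => k; rewrite !mxE; under eq_bigr do rewrite !mxE -natrM mulnb.
    by rewrite sum_F2_card; apply/eqP; rewrite natrF2_eq0 hS.
  rewrite -[RHS](mul0mx _ (rowsub (maxrankfun B) B)).
  move/(row_free_inj (maxrowsub_free B))/rowP/(_ i0)/eqP.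
  by rewrite !mxE i0S.
have le2 e : (#|[set i | e \in C (g i)]%SET| <= 2)%N.
  apply: leq_trans (C2 e); rewrite -(card_imset _ injg); apply: subset_leq_card.
  by apply/fintype.subsetP => f /imsetP[i]; rewrite !inE => h ->.
have C_neq0 i : C (g i) != finset.set0.
  have [|e] := indep [set i]%SET; first by apply/finset.set0Pn; exists i; rewrite inE.
  apply: contraTneq => Ci; rewrite (_ : [set _ in _ | _]%SET = finset.set0) ?cards0 //.
  by apply/setP => j; rewrite !inE; case: eqP => // ->; rewrite Ci inE.
have dc : (\sum_i #|C (g i)| <= 2 * #|E|)%N.
  under eq_bigr do rewrite -sum1_card big_mkcond /=.
  rewrite exchange_big /= (bigID (mem E)) /= [X in (_ + X)%N]big1 ?addn0; last first.
    move=> e neE; rewrite big1 // => i _; case: ifP => // /(fintype.subsetP (evC _).1).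
    by rewrite (negbTE neE).
  rewrite mulnC -sum_nat_const; apply: leq_sum => e _.
  by rewrite -big_mkcond /= sum1dep_card.
pose J := [set i | #|C (g i)| == 3]%SET.
have Jle : (#|J| <= #|G|)%N.
  apply: (triangles_leq (T := fun k : 'I_#|J| => C (g (enum_val k))) cG).
  - move=> k; apply: (even_set_triangle (evC _) (C_neq0 _)).2.
    by apply/eqP; move: (enum_valP k); rewrite inE.
  - move=> e; apply: leq_trans (le2 e).
    rewrite -(card_imset _ (@enum_val_inj _ (mem J))); apply: subset_leq_card.
    by apply/fintype.subsetP => f /imsetP[i]; rewrite !inE => h ->.
  - move=> S /finset.set0Pn[k kS].
    have [|e he] := indep [set enum_val k | k in S]%SET.
      by apply/finset.set0Pn; exists (enum_val k); apply: imset_f.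
    exists e; rewrite -(card_imset _ (@enum_val_inj _ (mem J))).
    rewrite (_ : imset _ _ = [set i in [set enum_val k | k in S]%SET | e \in C (g i)]%SET) //.
    apply/setP => i; rewrite !inE; apply/imsetP/andP => [[l]|[/imsetP[l lS ->] h]].
      by rewrite !inE => /andP[lS h] ->; split=> //; apply: imset_f.
    by exists l => //; rewrite !inE lS.
(* Each selected set has at least four edges, or three and then it is counted once more in [J]. *)
have : (4 * r <= \sum_i #|C (g i)| + #|J|)%N.
  rewrite -sum1dep_card [X in (_ + X)%N]big_mkcond -big_split /=.
  rewrite mulnC -[r in (r * 4)%N]card_ord -sum_nat_const; apply: leq_sum => i _.
  have [+ _] := even_set_triangle (evC (g i)) (C_neq0 i).
  by case: (#|C (g i)|) => [|[|[|[|n]]]].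
(* In total [4 |E| <= 4 r + 4 |V| <= 2 |E| + |J| + 4 |V|], with [|J| <= |V|]. *)
have arith (a b e n s : nat) : b <= n -> s <= 2 * e -> e <= a + n -> 4 * a <= s + b ->
  2 * e <= 5 * n by lia.
exact: arith Jle dc rk.
Qed.

End TwoBasis.

(** * Graphs drawn along a grid have a 2-basis *)

(* [(true, x)] is the horizontal and [(false, x)] the vertical grid edge whose
   left, respectively lower, end is [x]. *)
Definition gedge := (bool * (nat * nat))%type.

Definition gend1 (h : gedge) : nat * nat := h.2.

Definition gend2 (h : gedge) : nat * nat :=
  if h.1 then (h.2.1.+1, h.2.2) else (h.2.1, h.2.2.+1).

Definition gadj (x y : nat * nat) : Prop :=
  exists h, (x = gend1 h /\ y = gend2 h) \/ (x = gend2 h /\ y = gend1 h).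

Inductive gconn (P : nat * nat -> Prop) (x : nat * nat) : nat * nat -> Prop :=
| gconn_refl : P x -> gconn P x x
| gconn_step y z : gconn P x y -> gadj y z -> P z -> gconn P x z.

(* The unit square with lower left corner [x] is also denoted by [x]. *)
Definition gside1 (h : gedge) : nat * nat :=
  if h.1 then (h.2.1, h.2.2.-1) else (h.2.1.-1, h.2.2).

Definition gside2 (h : gedge) : nat * nat := h.2.

(** The boundary over F_2 of the chain [c] at the point [x]. Since [0.-1] is [0], it has this
    meaning at positive coordinates only, so branch sets are kept off the axes. *)
Definition gbd (c : gedge -> bool) (x : nat * nat) : bool :=
  c (true, x) (+) c (true, (x.1.-1, x.2)) (+) c (false, x) (+) c (false, (x.1, x.2.-1)).

Lemma gbd_pred1 h (x : nat * nat) : (0 < x.1)%N -> (0 < x.2)%N ->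
  gbd (pred1 h) x = (x == gend1 h) (+) (x == gend2 h).
Proof.
case: x => [[|a] [|b]] // _ _; case: h => [[] [a' b']]; rewrite /gbd /gend1 /gend2 /= !xpair_eqE /=;
  rewrite !eqSS; case: (a.+1 == a'); case: (a == a'); case: (b.+1 == b'); by case: (b == b').
Qed.

Lemma gbd_add (c c' : gedge -> bool) x :
  gbd (fun h => c h (+) c' h) x = gbd c x (+) gbd c' x.
Proof.
by rewrite /gbd [RHS]addbACA [X in _ = X (+) _]addbACA [X in _ = X (+) _ (+) _]addbACA.
Qed.

Lemma gbd_sum (I : finType) (P : pred I) (c : I -> gedge -> bool) x :
  gbd (fun h => \big[addb/false]_(i | P i) c i h) x = \big[addb/false]_(i | P i) gbd (c i) x.
Proof. by rewrite /gbd -!big_split. Qed.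

(** Adding up the edges of a walk mod 2 leaves a chain whose boundary consists of the two ends. *)
Lemma gconn_chain (P : nat * nat -> Prop) x y :
  (forall z, P z -> (0 < z.1)%N /\ (0 < z.2)%N) -> gconn P x y ->
  exists c : gedge -> bool, (forall h, c h -> P (gend1 h) /\ P (gend2 h)) /\
    forall z, (0 < z.1)%N -> (0 < z.2)%N -> gbd c z = (z == x) (+) (z == y).
Proof.
move=> posP; elim=> [Px|{}y z xy [c [cP cbd]] [h yz] Pz].
  by exists (fun=> false); split=> // z _ _; rewrite addbb.
have Py : P y by case: xy.
have [Ph1 Ph2] : P (gend1 h) /\ P (gend2 h) by case: yz => -[<- <-].
exists (fun k => c k (+) (k == h)); split=> [k|v v1 v2].
  by case: eqP => [->|_] //; rewrite addbF => /cP.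
rewrite gbd_add cbd // gbd_pred1 //.
by case: yz => -[<- <-]; case: (v == x); case: (v == y); case: (v == z).
Qed.

Lemma odd_card_addb (I : finType) (P : pred I) :
  odd #|[set i | P i]%SET| = \big[addb/false]_i P i.
Proof.
rewrite -sum1dep_card big_mkcond /= (big_morph odd oddD (erefl : odd 0 = false)).
by apply: eq_bigr => i _; case: (P i).
Qed.

Lemma addb_sum_shift n (F : nat -> bool) : F 0 = false -> F n.+1 = false ->
  \big[addb/false]_(a < n.+1) F a = \big[addb/false]_(a < n.+1) F a.+1.
Proof. by move=> F0 Fn; rewrite big_ord_recl F0 [RHS]big_ord_recr /= Fn addbF. Qed.

Section GridMinor.
(** [fib u] is the branch set of the vertex [u], and [r e] below is the grid edge that represents
    the edge [e]. *)
Variables (G : sgraph) (n : nat) (fib : G -> nat * nat -> Prop).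
Hypothesis fib_inj : forall u v x, fib u x -> fib v x -> u = v.
Hypothesis fib_box : forall u x, fib u x -> (0 < x.1 <= n)%N /\ (0 < x.2 <= n)%N.
Hypothesis fib_conn : forall u x y, fib u x -> fib u y -> gconn (fib u) x y.
Variables (r : {set G} -> gedge) (src tgt : {set G} -> G).
Hypothesis r_ends : forall e, e \in edges G ->
  [/\ e = [set src e; tgt e]%SET, fib (src e) (gend1 (r e)) & fib (tgt e) (gend2 (r e))].

Lemma src_neq_tgt e : e \in edges G -> src e != tgt e.
Proof.
move=> eG; have [E _ _] := r_ends eG; move: eG; rewrite {1}E mem_edges.
by apply: contraTneq => ->; rewrite adj_irr.
Qed.

Definition inner (h : gedge) := exists u, fib u (gend1 h) /\ fib u (gend2 h).

Definition kept (h : gedge) : bool :=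
  `[< inner h \/ exists2 e, e \in edges G & r e = h >].

Lemma r_not_inner e : e \in edges G -> ~ inner (r e).
Proof.
move=> eG [u [h1 h2]]; have [_ f1 f2] := r_ends eG.
by have := src_neq_tgt eG; rewrite (fib_inj f1 h1) (fib_inj f2 h2) eqxx.
Qed.

Lemma r_inj e e' : e \in edges G -> e' \in edges G -> r e = r e' -> e = e'.
Proof.
move=> eG eG' E; have [e1 f1 f2] := r_ends eG; have [e2 f1' f2'] := r_ends eG'.
rewrite E in f1 f2; rewrite e1 [RHS]e2.
by rewrite (fib_inj f1 f1') (fib_inj f2 f2').
Qed.

Lemma kept_r e : e \in edges G -> kept (r e).
Proof. by move=> eG; apply/asboolP; right; exists e. Qed.

Lemma kept_ends h : kept h -> (exists u, fib u (gend1 h)) /\ (exists u, fib u (gend2 h)).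
Proof.
case/asboolP => [[u [h1 h2]]|[e eG <-]]; first by split; exists u.
by have [_ f1 f2] := r_ends eG; split; [exists (src e)|exists (tgt e)].
Qed.

Definition gsq := ('I_n.+1 * 'I_n.+1)%type.
Definition to_sq (x : nat * nat) : gsq := (inord x.1, inord x.2).
Definition of_sq (s : gsq) : nat * nat := (s.1 : nat, s.2 : nat).

Lemma to_sqK x : (x.1 <= n)%N -> (x.2 <= n)%N -> of_sq (to_sq x) = x.
Proof. by case: x => a b /= an bn; rewrite /of_sq /= !inordK. Qed.

(** The grid edges with two different squares of the board as sides: at coordinate 0 the predecessor
    in [gside1] would give the same square twice. *)
Definition gbox (h : gedge) : bool :=
  [&& h.2.1 <= n, h.2.2 <= n & 0 < (if h.1 then h.2.2 else h.2.1)]%N.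

Lemma gbox_sides h : gbox h -> [/\ (gside1 h).1 <= n, (gside1 h).2 <= n,
  (gside2 h).1 <= n & (gside2 h).2 <= n]%N.
Proof. by case: h => [[] [a b]] /and3P[/= ? ? ?]; split=> //=; lia. Qed.

Definition sq_rel : rel gsq := fun s t =>
  `[< exists h, [/\ ~~ kept h, gbox h &
        (s = to_sq (gside1 h) /\ t = to_sq (gside2 h)) \/
        (t = to_sq (gside1 h) /\ s = to_sq (gside2 h))] >].

Lemma sq_rel_sym : symmetric sq_rel.
Proof.
move=> s t; apply/asboolP/asboolP => -[h [nk gb E]]; exists h; split=> //;
  by case: E; [right|left].
Qed.

Lemma sq_connect_sym : connect_sym sq_rel.
Proof. exact: sym_connect_sym sq_rel_sym. Qed.

Definition face (x : nat * nat) : gsq := fingraph.root sq_rel (to_sq x).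

Lemma face_not_kept h : ~~ kept h -> gbox h -> face (gside1 h) = face (gside2 h).
Proof.
move=> nk gb; apply/eqP; rewrite /face (root_connect sq_connect_sym).
by apply/connect1/asboolP; exists h; split=> //; left.
Qed.

Lemma face_const (w : nat * nat -> bool) :
  (forall h, ~~ kept h -> gbox h -> w (gside1 h) = w (gside2 h)) ->
  forall x, (x.1 <= n)%N -> (x.2 <= n)%N -> w x = w (of_sq (face x)).
Proof.
move=> wc x x1 x2; rewrite -{1}(to_sqK x1 x2) /face.
have /connectP[p + ->] := connect_root sq_rel (to_sq x).
elim: p (to_sq x) => //= t p IH s /andP[/asboolP[h [nk gb E]]] /IH <-.
have [? ? ? ?] := gbox_sides gb.
by case: E => -[-> ->]; rewrite !to_sqK // wc.
Qed.

(** The boundary of a face mod 2: an edge with [f] on both sides is left out. *)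
Definition face_edges (f : gsq) : {set {set G}} :=
  [set e in edges G | (face (gside1 (r e)) == f) (+) (face (gside2 (r e)) == f)]%SET.

Lemma face_edges_two e : (#|[set f | e \in face_edges f]%SET| <= 2)%N.
Proof.
apply: (@leq_trans #|[set face (gside1 (r e)); face (gside2 (r e))]%SET|); last first.
  by rewrite cards2; case: eqP.
apply: subset_leq_card; apply/fintype.subsetP => f; rewrite !inE => /andP[_].
by rewrite !(eq_sym f); case: eqP; case: eqP.
Qed.

Lemma gbox_fib h u : fib u (gend1 h) \/ fib u (gend2 h) -> (h.2.1 <= n)%N -> (h.2.2 <= n)%N ->
  gbox h.
Proof.
rewrite /gbox => fu -> -> /=; case: fu => /fib_box; rewrite /gend1 /gend2; case: h.1 => /=; lia.
Qed.

Lemma r_box e : e \in edges G -> gbox (r e).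
Proof.
move=> eG; have [_ f1 f2] := r_ends eG; apply: (gbox_fib (or_introl f1));
  have := fib_box f1; rewrite /gend1; lia.
Qed.

(** The jump function [chi] of the face has zero [gbd] at every interior grid point. Summed over the
    branch set of [u], this leaves the grid edges with exactly one end in it; among them, those in
    [chi] are kept and represent edges at [u]. *)
Lemma face_edges_even f : even_set (face_edges f).
Proof.
split; first by apply/fintype.subsetP => e; rewrite inE => /andP[].
move=> u.
have [chi [chibd chink chiE]] : exists chi : gedge -> bool,
    [/\ forall a b, (0 < a)%N -> (0 < b)%N -> gbd chi (a, b) = false,
        forall h, ~~ kept h -> gbox h -> chi h = false &
        forall e, (e \in face_edges f) = (e \in edges G) && chi (r e)].
  exists (fun h => (face (gside1 h) == f) (+) (face (gside2 h) == f)).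
  split=> [[|a] [|b]|h nk gb|e] //.
  - by rewrite /gbd /gside1 /gside2 /=; do 4 (case: (face _ == f)).
  - by rewrite face_not_kept // addbb.
  - by rewrite inE.
pose iu x := `[< fib u x >].
pose T h := (iu (gend1 h) (+) iu (gend2 h)) && chi h.
have iu_box x : iu x -> [/\ 0 < x.1, x.1 <= n, 0 < x.2 & x.2 <= n]%N.
  by move=> /asboolP /fib_box [/andP[? ?] /andP[? ?]].
pose S := (\big[addb/false]_(a < n.+1) \big[addb/false]_(b < n.+1)
             (T (true, (nat_of_ord a, nat_of_ord b)) (+) T (false, (nat_of_ord a, nat_of_ord b)))).
have S0 : S = false.
  transitivity (\big[addb/false]_(a < n.+1) \big[addb/false]_(b < n.+1)
     (iu (nat_of_ord a, nat_of_ord b) && gbd chi (nat_of_ord a, nat_of_ord b))); last first.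
    rewrite big1 // => a _; rewrite big1 // => b _; apply/negbTE/negP => /andP[/iu_box[/= ? _ ? _]].
    by rewrite chibd.
  rewrite /gbd /T /gend1 /gend2 /=.
  (* Summation by parts has no boundary terms, as branch sets avoid the coordinates [0] and
     [n.+1]. *)
  have sh1 (b : nat) : (b <= n)%N ->
     \big[addb/false]_(a < n.+1) (iu (nat_of_ord a, b) && chi (true, ((nat_of_ord a).-1, b))) =
     \big[addb/false]_(a < n.+1) (iu ((nat_of_ord a).+1, b) && chi (true, (nat_of_ord a, b))).
    move=> bn; apply: (addb_sum_shift (F := fun a => iu (a, b) && chi (true, (a.-1, b)))).
      by apply/negbTE/negP => /andP[/iu_box[]].
    by apply/negbTE/negP => /andP[/iu_box[]]; rewrite /= ltnn.
  have sh2 (a : nat) : (a <= n)%N ->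
     \big[addb/false]_(b < n.+1) (iu (a, nat_of_ord b) && chi (false, (a, (nat_of_ord b).-1))) =
     \big[addb/false]_(b < n.+1) (iu (a, (nat_of_ord b).+1) && chi (false, (a, nat_of_ord b))).
    move=> bn; apply: (addb_sum_shift (F := fun b => iu (a, b) && chi (false, (a, b.-1)))).
      by apply/negbTE/negP => /andP[/iu_box[]].
    by apply/negbTE/negP => /andP[/iu_box[]] _ _ _; rewrite /= ltnn.
  have e1 : \big[addb/false]_(a < n.+1) \big[addb/false]_(b < n.+1) (iu (nat_of_ord a, nat_of_ord b) && chi (true, ((nat_of_ord a).-1, nat_of_ord b)))
     = \big[addb/false]_(a < n.+1) \big[addb/false]_(b < n.+1) (iu ((nat_of_ord a).+1, nat_of_ord b) && chi (true, (nat_of_ord a, nat_of_ord b))).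
    rewrite exchange_big [RHS]exchange_big /=; apply: eq_bigr => b _; apply: sh1.
    by rewrite -ltnS.
  have e2 : \big[addb/false]_(a < n.+1) \big[addb/false]_(b < n.+1) (iu (nat_of_ord a, nat_of_ord b) && chi (false, (nat_of_ord a, (nat_of_ord b).-1)))
     = \big[addb/false]_(a < n.+1) \big[addb/false]_(b < n.+1) (iu (nat_of_ord a, (nat_of_ord b).+1) && chi (false, (nat_of_ord a, nat_of_ord b))).
    apply: eq_bigr => a _; apply: sh2.
    by rewrite -ltnS ltn_ord.
  rewrite /S /T /gend1 /gend2 /=.
  under eq_bigr do under eq_bigr do rewrite !andb_addl.
  under [RHS]eq_bigr do under eq_bigr do rewrite !andb_addr.
  under eq_bigr do rewrite !big_split /=.
  under [RHS]eq_bigr do rewrite !big_split /=.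
  by rewrite !big_split /= e1 e2 !addbA.
suff <- : S = odd #|[set e in face_edges f | u \in e]%SET| by rewrite S0.
(* A grid edge leaving the branch set of [u] either represents exactly one edge, which contains [u],
   or is not kept and has [chi h = false]. *)
have TE h : (h.2.1 <= n)%N -> (h.2.2 <= n)%N ->
    T h = \big[addb/false]_(e in edges G | u \in e) ((r e == h) && chi h).
  move=> h1 h2.
  have rin e : e \in edges G -> u \in e -> r e = h -> iu (gend1 h) (+) iu (gend2 h).
    move=> eG ue rh; have [E f1 f2] := r_ends eG; rewrite rh in f1 f2.
    have := src_neq_tgt eG; move: ue; rewrite {1}E !inE => /orP[] /eqP uE; rewrite -uE => ne.
      have -> : iu (gend1 h) by apply/asboolP; rewrite uE.
      by apply/negP => /asboolP /(fib_inj f2) ut; rewrite ut eqxx in ne.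
    have -> : iu (gend2 h) by apply/asboolP; rewrite uE.
    by rewrite addbT; apply/negP => /asboolP /(fib_inj f1) ut; rewrite ut eqxx in ne.
  have [diff|same] := boolP (iu (gend1 h) (+) iu (gend2 h)); last first.
    rewrite /T (negbTE same) big1 // => e /andP[eG ue].
    by case: eqP => // /(rin _ eG ue); rewrite (negbTE same).
  rewrite /T diff /=.
  have [/asboolP[[v [v1 v2]]|[e eG re]]|nk] := boolP (kept h).
  - move: diff; have iuE x : fib v x -> iu x = (u == v).
      by move=> vx; apply/asboolP/eqP => [/fib_inj/(_ vx)|->].
    by rewrite !iuE // addbb.
  - have ue : u \in e.
      have [E f1 f2] := r_ends eG; rewrite re in f1 f2; rewrite E !inE.
      apply: contraTT diff; rewrite negb_or => /andP[us ut].
      have -> : iu (gend1 h) = false by apply/negbTE/negP => /asboolP /fib_inj/(_ f1) uE; rewrite uE eqxx in us.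
      have -> // : iu (gend2 h) = false by apply/negbTE/negP => /asboolP /fib_inj/(_ f2) uE; rewrite uE eqxx in ut.
    rewrite (bigD1 e) /= ?eG ?ue // re eqxx big1 ?addbF // => e' /andP[/andP[eG' _] ne].
    by case: eqP => // re'; case/negP: ne; apply/eqP/r_inj => //; rewrite re'.
  - have gb : gbox h.
      move: diff; case: (boolP (iu (gend1 h))) => [/asboolP f1 _|_ /asboolP f2].
        exact: (gbox_fib (or_introl f1)).
      exact: (gbox_fib (or_intror f2)).
    by rewrite chink // big1 // => e _; rewrite andbF.
have -> : S = \big[addb/false]_(e in edges G | u \in e) \big[addb/false]_(a < n.+1) \big[addb/false]_(b < n.+1)
     (((r e == (true, (nat_of_ord a, nat_of_ord b))) && chi (true, (nat_of_ord a, nat_of_ord b))) (+)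
      ((r e == (false, (nat_of_ord a, nat_of_ord b))) && chi (false, (nat_of_ord a, nat_of_ord b)))).
  rewrite exchange_big; apply: eq_bigr => a _; rewrite exchange_big; apply: eq_bigr => b _.
  by rewrite !TE ?big_split //= -ltnS.
rewrite odd_card_addb big_mkcond /=; apply: eq_bigr => e _.
rewrite chiE; case: (boolP (e \in edges G)) => //= eG; case: (u \in e); rewrite ?andbF ?andbT //.
have := r_box eG; rewrite /gbox => /and3P[r1 r2 _].
rewrite (bigD1 (inord (r e).2.1)) //= (bigD1 (inord (r e).2.2)) //= !inordK //.
rewrite -[((r e).2.1, (r e).2.2)]surjective_pairing.
rewrite !big1 ?addbF.
- case E : (r e) => [[] x] /=; rewrite !eqxx /= ?addbF //.
- move=> a ne; rewrite big1 // => b _.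
  have ne' d : (r e == (d, (nat_of_ord a, nat_of_ord b))) = false.
    apply/negP => /eqP E; case/negP: ne; apply/eqP/val_inj; rewrite /= inordK //.
    by rewrite E.
  by rewrite !ne'.
- move=> b ne.
  have ne' d : (r e == (d, ((r e).2.1, nat_of_ord b))) = false.
    apply/negP => /eqP E; case/negP: ne; apply/eqP/val_inj; rewrite /= inordK //.
    by rewrite E.
  by rewrite !ne'.
Qed.

(** The chain runs inside the branch set of [src e] from its base point to [r e], crosses [r e], and
    continues inside the branch set of [tgt e] to its base point. The base points depend on the
    vertices only, so boundaries cancel in an even set. *)
Lemma lift_edge : exists c : {set G} -> gedge -> bool, exists base : G -> nat * nat,
  forall e, e \in edges G -> [/\ forall h, c e h -> kept h,
    forall e', e' \in edges G -> c e (r e') = (e == e') &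
    forall z, (0 < z.1)%N -> (0 < z.2)%N ->
      gbd (c e) z = (z == base (src e)) (+) (z == base (tgt e))].
Proof.
(* The point [(0, 0)] is a default value for vertices with empty branch set. *)
have /boolp.choice[base hbase] : forall u, exists y, (exists x, fib u x) -> fib u y.
  move=> u; case: (pselect (exists x, fib u x)) => [[x ux]|no]; first by exists x.
  by exists (0, 0)%N => /no.
suff /boolp.choice[c hc] : forall e, exists c : gedge -> bool, e \in edges G ->
  [/\ forall h, c h -> kept h,
    forall e', e' \in edges G -> c (r e') = (e == e') &
    forall z, (0 < z.1)%N -> (0 < z.2)%N ->
      gbd c z = (z == base (src e)) (+) (z == base (tgt e))].
  by exists c, base.
move=> e; have [eG|_] := boolP (e \in edges G); last by exists (fun=> false).
have [E f1 f2] := r_ends eG.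
have pos u z : fib u z -> (0 < z.1)%N /\ (0 < z.2)%N.
  by move=> /fib_box [/andP[? ?] /andP[? ?]].
have b1 : fib (src e) (base (src e)) by apply: hbase; exists (gend1 (r e)).
have b2 : fib (tgt e) (base (tgt e)) by apply: hbase; exists (gend2 (r e)).
have [c1 [in1 bd1]] := gconn_chain (pos _) (fib_conn b1 f1).
have [c2 [in2 bd2]] := gconn_chain (pos _) (fib_conn b2 f2).
exists (fun h => (c1 h (+) c2 h) (+) (pred1 (r e) h)) => _; split.
- move=> h /=; have [->|_] := h =P r e; first by rewrite kept_r.
  rewrite addbF => h12; apply/asboolP; left.
  have [c1h|/negbTE nc1] := boolP (c1 h); first by exists (src e); apply: in1.
  by rewrite nc1 in h12; exists (tgt e); apply: in2.
- move=> e' eG' /=.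
  have -> : c1 (r e') = false.
    by apply/negP => /in1 h; apply: (r_not_inner eG'); exists (src e).
  have -> : c2 (r e') = false.
    by apply/negP => /in2 h; apply: (r_not_inner eG'); exists (tgt e).
  by rewrite /= eq_sym; apply/eqP/eqP => [/(r_inj eG eG')|->].
- move=> z z1 z2; rewrite !gbd_add bd1 // bd2 // gbd_pred1 //.
  by do 2!case: (z == base _); case: (z == gend1 _); case: (z == gend2 _).
Qed.

(** A discrete Jordan curve argument: the lift [C] of [Z] is closed, and [w] is the parity of its
    crossings with the upward ray from a square. It changes exactly across [C], hence is constant on
    faces, and [Z] is the sum of the boundaries of the faces where it is true. *)
Lemma face_edges_span (Z : {set {set G}}) : even_set Z ->
  exists S : {set gsq}, forall e, (e \in Z) = odd #|[set f in S | e \in face_edges f]%SET|.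
Proof.
move=> [ZG evZ]; have [c [base hc]] := lift_edge.
have sub e : e \in Z -> e \in edges G by apply/fintype.subsetP.
pose C h := \big[addb/false]_(e in Z) c e h.
have Ck h : ~~ kept h -> C h = false.
  by move=> nk; rewrite /C big1 // => e /sub/hc[kc _ _]; apply: contraNF nk; apply: kc.
have Cr e : e \in edges G -> C (r e) = (e \in Z).
  move=> eG; rewrite /C; have [eZ|neZ] := boolP (e \in Z).
    rewrite (bigD1 e) //= big1 ?addbF; first by have [_ -> //] := hc _ eG; rewrite eqxx.
    by move=> e' /andP[/sub eG' ne]; have [_ -> //] := hc _ eG'; rewrite (negbTE ne).
  rewrite big1 // => e' eZ'; have [_ -> //] := hc _ (sub _ eZ').
  by move=> _; apply/negbTE; apply: contraNneq neZ => <-.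
(* The base point of [u] is counted once for each edge of [Z] at [u], an even number of times. *)
have Cbd z : (0 < z.1)%N -> (0 < z.2)%N -> gbd C z = false.
  move=> z1 z2; rewrite /C gbd_sum.
  transitivity (\big[addb/false]_(e in Z) \big[addb/false]_(u in e) (z == base u)).
    apply: eq_bigr => e /sub eG; have [_ _ -> //] := hc _ eG.
    have [E _ _] := r_ends eG; rewrite [in RHS]E big_setU1 ?big_set1 ?inE //.
    exact: src_neq_tgt.
  under eq_bigr do rewrite big_mkcond.
  rewrite exchange_big big1 //= => u _.
  case: (z == base u); last by rewrite big1 // => e _; rewrite if_same.
  apply/negbTE; apply: etrans (evZ u); congr (~~ _).
  rewrite odd_card_addb [LHS]big_mkcond; apply: eq_bigr => e _.
  by case: (e \in Z); case: (u \in e).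
pose w (x : nat * nat) := \big[addb/false]_(x.2.+1 <= k < n.+1) C (true, (x.1, k)).
have wh a b : (0 < b <= n)%N -> w (a, b.-1) (+) w (a, b) = C (true, (a, b)).
  by case: b => // b /andP[_ bn]; rewrite /w /= big_ltn // addbK.
(* Induction downwards from the top row [n], above which nothing is kept; the step uses that [C] is
   closed at the point [(a, b.+1)]. *)
have wv a b : (0 < a <= n)%N -> (b <= n)%N -> w (a.-1, b) (+) w (a, b) = C (false, (a, b)).
  move=> /andP[a0 an] bn; have [m] := ubnP (n - b); elim: m b bn => // m IH b bn lm.
  have [bn'|] := ltnP b n; last first.
    move=> nb; have -> : b = n by apply/eqP; rewrite eqn_leq bn.
    rewrite /w /= !big_geq // Ck //; apply/negP => /kept_ends[_ [u /fib_box]].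
    by rewrite /gend2 /= ltnn => -[].
  have := wh a b.+1; have := wh a.-1 b.+1; rewrite /= bn' => /(_ isT) h1 /(_ isT) h2.
  have h3 : w (a.-1, b.+1) (+) w (a, b.+1) = C (false, (a, b.+1)) by apply: IH => //; lia.
  have := Cbd (a, b.+1) a0 isT; rewrite /gbd /= -h1 -h2 -h3.
  by case: (w _); case: (w _); case: (w _); case: (w _); case: (C _).
have ww h : gbox h -> w (gside1 h) (+) w (gside2 h) = C h.
  by case: h => [[] [a b]] /and3P[/= ? ? ?]; rewrite /gside1 /gside2 /=;
    [apply: wh|apply: wv] => //; apply/andP.
have wface := @face_const w.
exists [set f | w (of_sq f)]%SET => e.
have [eG|neG] := boolP (e \in edges G); last first.
  rewrite (contraNF (@sub e) neG) (_ : [set _ in _ | _]%SET = finset.set0) ?cards0 //.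
  by apply/setP => f; rewrite !inE (negbTE neG) andbF.
rewrite -Cr // -ww ?r_box // odd_card_addb.
have [s1 s2 s3 s4] := gbox_sides (r_box eG).
have wc h : ~~ kept h -> gbox h -> w (gside1 h) = w (gside2 h).
  by move=> nk gb; have := ww _ gb; rewrite Ck //; case: (w _); case: (w _).
rewrite (wface wc _ s1 s2) (wface wc _ s3 s4).
under [RHS]eq_bigr do rewrite !inE eG /= andb_addr.
rewrite big_split /=; congr addb.
  rewrite (bigD1 (face (gside1 (r e)))) //= eqxx andbT big1 ?addbF // => f /negbTE.
  by rewrite eq_sym => ->; rewrite andbF.
rewrite (bigD1 (face (gside2 (r e)))) //= eqxx andbT big1 ?addbF // => f /negbTE.
by rewrite eq_sym => ->; rewrite andbF.
Qed.

Lemma grid_minor_bound : critical 4 G -> (2 * #|edges G| <= 5 * #|G|)%N.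
Proof. exact: (two_basis_bound face_edges_even face_edges_span face_edges_two). Qed.

End GridMinor.

(** * From plane drawings to grids *)

Section Plane.
Variable R : realType.
Local Open Scope classical_set_scope.
Local Open Scope ring_scope.

Definition close (d : R) (a b : R * R) : Prop := `|a.1 - b.1| < d /\ `|a.2 - b.2| < d.

(** The sum of the coordinate distances attains a positive minimum on [A] times [B]; half of it
    bounds both coordinates at once. *)
Lemma compact_separated (A B : set (R * R)) : compact A -> compact B ->
  (forall a, A a -> ~ B a) ->
  exists2 d : R, 0 < d & forall a b, A a -> B b -> ~ close d a b.
Proof.
move=> cA cB AB.
have [[ab0 ab0P]|noab] := pselect (A `*` B !=set0); last first.
  by exists 1 => // a b Aa Bb; case: noab; exists (a, b).
pose f (ab : (R * R) * (R * R)) : R := `|ab.1.1 - ab.2.1| + `|ab.1.2 - ab.2.2|.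
have cf : {within A `*` B, continuous f}.
  apply: continuous_subspaceT => x; rewrite /f.
  have c11 : {for x, continuous (fun ab : (R * R) * (R * R) => ab.1.1)}.
    by apply: (@continuous_comp _ _ _ fst fst); [exact: cvg_fst|exact: cvg_fst].
  have c12 : {for x, continuous (fun ab : (R * R) * (R * R) => ab.1.2)}.
    by apply: (@continuous_comp _ _ _ fst snd); [exact: cvg_fst|exact: cvg_snd].
  have c21 : {for x, continuous (fun ab : (R * R) * (R * R) => ab.2.1)}.
    by apply: (@continuous_comp _ _ _ snd fst); [exact: cvg_snd|exact: cvg_fst].
  have c22 : {for x, continuous (fun ab : (R * R) * (R * R) => ab.2.2)}.
    by apply: (@continuous_comp _ _ _ snd snd); [exact: cvg_snd|exact: cvg_snd].
  by apply: cvgD; apply: cvg_norm; apply: cvgB.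
have ne : A `*` B !=set0 by exists ab0.
have [m] := compact_EVT_min ne (compact_setX cA cB) cf.
rewrite inE => -[Am Bm] minm.
have fm : 0 < f m.
  rewrite lt_neqAle addr_ge0 // andbT eq_sym; apply/negP; rewrite paddr_eq0 //.
  rewrite !normr_eq0 !subr_eq0 => /andP[/eqP e1 /eqP e2]; apply: (AB _ Am).
  by rewrite [m.1]surjective_pairing e1 e2 -surjective_pairing.
exists (f m / 2); first by rewrite divr_gt0.
move=> a b Aa Bb [h1 h2]; have := minm (a, b); rewrite inE => /(_ (conj Aa Bb)).
by rewrite {2}/f /=; lra.
Qed.

Lemma compact_box (A : set (R * R)) : compact A ->
  exists M : R, forall a, A a -> `|a.1| <= M /\ `|a.2| <= M.
Proof.
move=> /compact_bounded[M [_ /(_ (M + 1))]]; rewrite ltrDl ltr01 => /(_ isT) h.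
exists (M + 1) => a /h /=; rewrite prod_normE; rewrite ge_max => /andP[]; by split.
Qed.

(** The class of [t] is open and closed in the interval, which is connected. *)
Lemma segment_locally_connected (a b : R) (E : R -> R -> Prop) :
  (forall t, E t t) -> (forall t u, E t u -> E u t) ->
  (forall t u v, E t u -> E u v -> E t v) ->
  (forall t, t \in `[a, b] -> exists2 d, 0 < d & forall u, u \in `[a, b] -> `|u - t| < d -> E t u) ->
  forall t u, t \in `[a, b] -> u \in `[a, b] -> E t u.
Proof.
move=> Er Es Et /= loc t u tab uab.
have /boolp.choice[d dP] : forall t, exists d, t \in `[a, b] -> 0 < d /\
     forall u, u \in `[a, b] -> `|u - t| < d -> E t u.
  move=> v; have [vab|nv] := boolP (v \in `[a, b]); last by exists 0.
  by have [d d0 dE] := loc _ vab; exists d.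
pose B := [set v | v \in `[a, b] /\ E t v].
pose U (P : R -> Prop) := \bigcup_(v in [set v | v \in `[a, b] /\ P v]) ball v (d v).
have oU P : open (U P).
  by apply: bigcup_open => v [/dP[d0 _] _]; apply: ball_open.
have inU P v : v \in `[a, b] -> P v -> U P v.
  by move=> vab Pv; exists v => //; apply: ballxx; have [] := dP _ vab.
suff BE : B = [set` `[a, b]] by have : [set` `[a, b]] u by []; rewrite -BE => -[].
apply: segment_connected.
- by exists t.
- exists (U (E t)) => //; apply/seteqP; split=> v /=.
    by move=> [vab tv]; split=> //; apply: inU.
  move=> [vab [w [wab tw] wv]]; split=> //; apply: Et tw _.
  by have [_] := dP _ wab; apply=> //; rewrite distrC.
- exists (~` U (fun v => ~ E t v)); first exact: open_closedC.
  apply/seteqP; split=> v /=.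
    move=> [vab tv]; split=> // -[w [wab ntw] wv]; apply: ntw; apply: Et tv _; apply: Es.
    by have [_] := dP _ wab; apply=> //; rewrite distrC.
  move=> [vab nU]; split=> //; apply: contrapT => ntv; apply: nU; exact: inU.
Qed.

End Plane.

(** * Connectivity in the grid *)

Lemma gadj_sym x y : gadj x y -> gadj y x.
Proof. by move=> [h [] [-> ->]]; exists h; [right|left]. Qed.

Section GConn.
Implicit Types (P Q : nat * nat -> Prop) (x y z : nat * nat).

Lemma gconn_end P x y : gconn P x y -> P x /\ P y.
Proof. by elim=> // ? ? _ [? ?]. Qed.

Lemma gconn_trans P x y z : gconn P x y -> gconn P y z -> gconn P x z.
Proof. by move=> xy; elim=> // u v _ xu uv Pv; apply: gconn_step xu uv Pv. Qed.

Lemma gconn_sym P x y : gconn P x y -> gconn P y x.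
Proof.
elim=> [Px|u v xu IH uv Pv]; first exact: gconn_refl.
apply: gconn_trans IH; apply: (gconn_step (gconn_refl Pv)); first exact: gadj_sym.
by case: (gconn_end xu).
Qed.

Lemma gconn_mono P Q x y : (forall z, P z -> Q z) -> gconn P x y -> gconn Q x y.
Proof.
move=> PQ; elim=> [/PQ|u v _ IH uv /PQ Qv]; first exact: gconn_refl.
exact: gconn_step IH uv Qv.
Qed.

Lemma gconn_reach P x y : gconn P x y -> gconn (gconn P x) x y.
Proof.
elim=> [Px|u v xu IH uv Pv]; first by apply/gconn_refl/gconn_refl.
by apply: (gconn_step IH uv); apply: gconn_step xu uv Pv.
Qed.

Lemma gconn_first_hit P Q x y : gconn P x y -> ~ Q x -> Q y ->
  exists z z', [/\ gconn (fun v => P v /\ ~ Q v) x z, gadj z z' & Q z'].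
Proof.
move=> xy nQx; have : (gconn (fun v => P v /\ ~ Q v) x y) \/
  exists z z', [/\ gconn (fun v => P v /\ ~ Q v) x z, gadj z z' & Q z'].
  elim: xy => [Px|u v _ IH uv Pv]; first by left; apply: gconn_refl.
  case: IH => [xu|]; last by right.
  have [Qv|nQv] := pselect (Q v); first by right; exists u, v.
  by left; apply: gconn_step xu uv _.
by case=> // h; have [_ [_]] := gconn_end h.
Qed.

Lemma gconn_square P a b : P (a, b) -> P (a.+1, b) -> P (a, b.+1) -> P (a.+1, b.+1) ->
  forall x y, (x.1 = a \/ x.1 = a.+1) /\ (x.2 = b \/ x.2 = b.+1) ->
  (y.1 = a \/ y.1 = a.+1) /\ (y.2 = b \/ y.2 = b.+1) -> gconn P x y.
Proof.
move=> P00 P10 P01 P11.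
have h c d : gadj (c, d) (c.+1, d) by exists (true, (c, d)); left.
have v c d : gadj (c, d) (c, d.+1) by exists (false, (c, d)); left.
have c00 := gconn_refl P00.
have c10 := gconn_step c00 (h a b) P10.
have c01 := gconn_step c00 (v a b) P01.
have c11 := gconn_step c10 (v a.+1 b) P11.
have all x : (x.1 = a \/ x.1 = a.+1) /\ (x.2 = b \/ x.2 = b.+1) -> gconn P (a, b) x.
  by case: x => ? ? /= [[->|->] [->|->]].
by move=> x y /all/gconn_sym xa /all; apply: gconn_trans.
Qed.

End GConn.

(** * Rounding points of the plane to a grid of mesh [h] *)

Section Cells.
Variables (R : realType) (M h : R).
Local Open Scope classical_set_scope.
Local Open Scope ring_scope.
Hypothesis h_gt0 : 0 < h.

Definition inbox (z : R * R) : Prop := `|z.1| <= M /\ `|z.2| <= M.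

(** The shift by [M + h] makes the index at least 1 whenever [x] has absolute value at most [M]. *)
Definition cell1 (x : R) : nat := Num.truncn ((x + M + h) / h).

Definition cell (z : R * R) : nat * nat := (cell1 z.1, cell1 z.2).

(** Rounding to all four corners of the cell makes points closer than [h] share a corner, so that
    arcs become connected; conversely, points sharing a corner are closer than [3 * h]. *)
Definition corner (z : R * R) (g : nat * nat) : Prop :=
  (g.1 = cell1 z.1 \/ g.1 = (cell1 z.1).+1) /\ (g.2 = cell1 z.2 \/ g.2 = (cell1 z.2).+1).

Definition corners (A : set (R * R)) (g : nat * nat) : Prop := exists2 z, A z & corner z g.

Lemma cell1_itv x : `|x| <= M ->
  (cell1 x)%:R * h <= x + M + h < (cell1 x)%:R * h + h.
Proof.
move=> xM; have : 0 <= (x + M + h) / h.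
  apply: divr_ge0; last exact: ltW.
  by move: xM; rewrite ler_norml => /andP[? ?]; move: h_gt0; lra.
move=> /truncn_itv/andP[]; rewrite -/(cell1 x) -natr1 ler_pdivlMr // ltr_pdivrMr // => l1 l2.
by apply/andP; split; lra.
Qed.

Lemma cell1_box x : `|x| <= M ->
  (0 < cell1 x)%N /\ ((cell1 x).+1 <= (Num.truncn ((2 * M + h) / h)).+1)%N.
Proof.
move=> xM; have [l1 l2] : - M <= x /\ x <= M by move: xM; rewrite ler_norml => /andP[].
split; last first.
  rewrite ltnS; apply: le_truncn; rewrite ler_pM2r ?invr_gt0 //; lra.
by rewrite truncn_gt0 ler_pdivlMr // mul1r; move: h_gt0; lra.
Qed.

Lemma cell1_near x y : `|x| <= M -> `|y| <= M -> `|x - y| < h -> (cell1 x <= (cell1 y).+1)%N.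
Proof.
move=> /cell1_itv/andP[x1 x2] /cell1_itv/andP[y1 y2]; rewrite ltr_norml => /andP[d1 d2].
have : (cell1 x)%:R * h < ((cell1 y).+2)%:R * h by rewrite -!natr1; lra.
by rewrite ltr_pM2r // ltr_nat ltnS.
Qed.

Lemma corner_cell z : corner z (cell z).
Proof. by split; left. Qed.

Lemma corner_box z g : inbox z -> corner z g ->
  (0 < g.1 <= (Num.truncn ((2 * M + h) / h)).+1)%N /\
  (0 < g.2 <= (Num.truncn ((2 * M + h) / h)).+1)%N.
Proof.
by move=> [/cell1_box[? ?] /cell1_box[? ?]] [[->|->] [->|->]]; lia.
Qed.

Lemma corner_close z z' g : inbox z -> inbox z' -> corner z g -> corner z' g ->
  close (3 * h) z z'.
Proof.
have aux x y k : `|x| <= M -> `|y| <= M -> k = cell1 x \/ k = (cell1 x).+1 ->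
    k = cell1 y \/ k = (cell1 y).+1 -> `|x - y| < 3 * h.
  move=> /cell1_itv/andP[x1 x2] /cell1_itv/andP[y1 y2] kx ky.
  have {}kx : k%:R * h <= (cell1 x)%:R * h + h /\ (cell1 x)%:R * h <= k%:R * h.
    by move: h_gt0; case: kx => ->; rewrite -?natr1 => ?; split; lra.
  have {}ky : k%:R * h <= (cell1 y)%:R * h + h /\ (cell1 y)%:R * h <= k%:R * h.
    by move: h_gt0; case: ky => ->; rewrite -?natr1 => ?; split; lra.
  by rewrite ltr_norml; apply/andP; split; lra.
move=> [z1 z2] [z1' z2'] [g1 g2] [g1' g2'].
by split; [apply: aux g1 g1'|apply: aux g2 g2'].
Qed.

Lemma corner_conn (P : nat * nat -> Prop) z x y : (forall g, corner z g -> P g) ->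
  corner z x -> corner z y -> gconn P x y.
Proof.
move=> cP xz yz; apply: (@gconn_square _ (cell1 z.1) (cell1 z.2)) => //; apply: cP.
- by split; left.
- by split; [right|left].
- by split; [left|right].
- by split; right.
Qed.

Lemma cell_near_conn (P : nat * nat -> Prop) z z' : inbox z -> inbox z' -> close h z z' ->
  (forall g, corner z g -> P g) -> (forall g, corner z' g -> P g) -> gconn P (cell z) (cell z').
Proof.
move=> [z1 z2] [z1' z2'] [d1 d2] zP zP'.
have aux x y : `|x| <= M -> `|y| <= M -> `|x - y| < h ->
    exists k, (k = cell1 x \/ k = (cell1 x).+1) /\ (k = cell1 y \/ k = (cell1 y).+1).
  move=> hx hy hxy; have := cell1_near hx hy hxy; rewrite distrC in hxy.
  have := cell1_near hy hx hxy => l1 l2.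
  have [le|lt] := leqP (cell1 x) (cell1 y).
    exists (cell1 y); split; last by left.
    have [yx|xy] := leqP (cell1 y) (cell1 x); [left|right]; apply/eqP; rewrite eqn_leq.
      by rewrite yx le.
    by rewrite l1 xy.
  exists (cell1 x); split; first by left.
  by right; apply/eqP; rewrite eqn_leq l2 lt.
have [a [a1 a2]] := aux _ _ z1 z1' d1; have [b [b1 b2]] := aux _ _ z2 z2' d2.
apply: (@gconn_trans _ _ (a, b)).
  by apply: (corner_conn zP (corner_cell z)).
by apply: (corner_conn zP') => //; exact: corner_cell.
Qed.

(** By continuity the cells at nearby parameters are linked inside [P]; connectedness of the
    interval extends this to all parameters. *)
Lemma corners_path_conn (P : nat * nat -> Prop) (f : R -> R * R) (a b : R) :
  {within `[a, b], continuous f} -> (forall t, t \in `[a, b] -> inbox (f t)) ->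
  (forall t g, t \in `[a, b] -> corner (f t) g -> P g) ->
  forall t u x y, t \in `[a, b] -> u \in `[a, b] -> corner (f t) x -> corner (f u) y -> gconn P x y.
Proof.
move=> cf fM fP t u x y tab uab tx uy.
(* Equality is included because [gconn] is reflexive only on [P], whereas [E] has to be reflexive at
   all reals. *)
pose E v w := v = w \/ gconn P (cell (f v)) (cell (f w)).
have Etu : E t u.
  apply: (@segment_locally_connected R a b) => //.
  - by move=> v; left.
  - by move=> v w [->|/gconn_sym]; [left|right].
  - by move=> v w r [->//|vw] [<-|wr]; right => //; apply: gconn_trans vw wr.
  - move=> v vab.
    have /subspace_continuousP/(_ v vab)/cvg_ballP/(_ h h_gt0) := cf.
    rewrite near_withinE => /nbhs_ballP[d d0 hd]; exists d => // w wab wv; right.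
    have [] := hd w _ wab; first by rewrite /ball /= distrC.
    move=> b1 b2; apply: cell_near_conn; [exact: fM|exact: fM|by split| |];
      by move=> g; apply: fP.
have h1 : gconn P x (cell (f t)).
  by apply: (@corner_conn _ (f t)) => // [g|]; [apply: fP|exact: corner_cell].
have h2 : gconn P (cell (f u)) y.
  by apply: (@corner_conn _ (f u)) => // [g|]; [apply: fP|exact: corner_cell].
case: Etu => [tu|h3]; first by apply: gconn_trans h1 _; rewrite tu.
by apply: gconn_trans h1 (gconn_trans h3 h2).
Qed.

End Cells.

Lemma half_neq (R : realType) (t : R) :
  ((1 / 2 <= t)%R -> t <> 0%R) /\ ((t <= 1 / 2)%R -> t <> 1%R).
Proof. by split=> ? ?; lra. Qed.

(** * Branch sets obtained from a plane drawing *)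

Section Drawing.
Variables (R : realType) (G : sgraph) (p : G -> R * R) (c : {set G} -> R -> R * R) (g0 : G).
Local Open Scope classical_set_scope.
Local Open Scope ring_scope.
Hypothesis pc : plane_drawing p c.

Lemma drawing_ends : exists src tgt : {set G} -> G, forall e, e \in edges G ->
  [/\ e = [set src e; tgt e]%SET, src e != tgt e, c e 0 = p (src e) & c e 1 = p (tgt e)].
Proof.
case: pc => injp arcs _ _.
have /boolp.choice[st stP] : forall e, exists st : G * G, e \in edges G ->
    [/\ e = [set st.1; st.2]%SET, st.1 != st.2, c e 0 = p st.1 & c e 1 = p st.2].
  move=> e; have [eG|neG] := boolP (e \in edges G); last first.
    by exists (g0, g0).
  have [_ injc ends] := arcs e eG; have /edgesP[x [y [xy eE]]] := eG.
  have nxy : x != y by apply: contraTneq xy => ->; rewrite adj_irr.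
  have n01 : c e 0 <> c e 1.
    move=> h; have := injc 0 1; rewrite !in_itv /= !lexx ler01 => /(_ isT isT h) /eqP.
    by rewrite eq_sym oner_eq0.
  have [u ue c0] : (p @` [set z | z \in e]) (c e 0) by rewrite -ends; left.
  have [v ve c1] : (p @` [set z | z \in e]) (c e 1) by rewrite -ends; right.
  exists (u, v) => _ /=; have nuv : u != v by apply: contra_notN n01 => /eqP uv; rewrite -c0 -c1 uv.
  split=> //; move: ue ve nuv; rewrite /= eE !inE.
  move=> /orP[] /eqP -> /orP[] /eqP ->; rewrite ?eqxx // => _; by rewrite finset.setUC.
by exists (fun e => (st e).1), (fun e => (st e).2).
Qed.

Variables (src tgt : {set G} -> G).
Hypothesis st : forall e, e \in edges G ->
  [/\ e = [set src e; tgt e]%SET, src e != tgt e, c e 0 = p (src e) & c e 1 = p (tgt e)].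

(** The arc of a set that is not an edge is empty, so that compactness holds for every [e]. *)
Let arc (e : {set G}) (a b : R) : set (R * R) :=
  [set c e t | t in [set t | e \in edges G /\ t \in `[a, b]]].
Let head e := arc e 0 (1 / 2).
Let tail e := arc e (1 / 2) 1.

Lemma arc_vertex e (t : R) x : e \in edges G -> t \in `[0, 1] -> c e t = p x ->
  (t = 0 /\ x = src e) \/ (t = 1 /\ x = tgt e).
Proof.
move=> eG t01 ctx; have [injp _ avoid _] := pc; have [_ _ c0 c1] := st eG.
have [h|] := boolP (t \in `]0, 1[); first by case: (avoid e eG t h x).
move: t01; rewrite !in_itv /= => /andP[t0 t1]; rewrite negb_and -!leNgt => /orP[] h.
  have t0' : t = 0 by apply/eqP; rewrite eq_le t0 h.
  by left; split=> //; apply: injp; rewrite -ctx t0'.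
have t1' : t = 1 by apply/eqP; rewrite eq_le t1 h.
by right; split=> //; apply: injp; rewrite -ctx t1'.
Qed.

Lemma arcs_meet e e' (t t' : R) : e \in edges G -> e' \in edges G -> e <> e' ->
  t \in `[0, 1] -> t' \in `[0, 1] -> c e t = c e' t' -> (t = 0 \/ t = 1) /\ (t' = 0 \/ t' = 1).
Proof.
move=> eG eG' ne t01 t01' E; have [_ _ _ avoid] := pc.
have ends (v : R) : v \in `[0, 1] -> v \notin `]0, 1[ -> v = 0 \/ v = 1.
  rewrite !in_itv /= => /andP[v0 v1]; rewrite negb_and -!leNgt => /orP[] h; [left|right];
    by apply/eqP; rewrite eq_le ?v0 ?v1 h.
split; apply: ends => //; apply/negP => h.
  exact: (avoid e e' eG eG' ne t t' h t01' E).
by apply: (avoid e' e eG' eG _ t' t h t01 (esym E)) => E'; apply: ne.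
Qed.

Lemma arc_compact e (a b : R) : 0 <= a -> b <= 1 -> compact (arc e a b).
Proof.
move=> a0 b1; have [eG|neG] := boolP (e \in edges G); last first.
  rewrite (_ : arc e a b = set0); first exact: compact0.
  by apply/seteqP; split=> // z [t [] h]; rewrite h in neG.
have [_ /(_ e eG)[ce _ _] _ _] := pc.
rewrite (_ : arc e a b = [set c e t | t in `[a, b]]); last first.
  by apply/seteqP; split=> z [t]; [move=> [_ tab]|move=> tab] => <-; exists t.
apply: continuous_compact; last exact: segment_compact.
apply: continuous_subspaceW ce => t /=; rewrite !in_itv /= => /andP[? ?].
by apply/andP; split; lra.
Qed.

Lemma half_sub (a b t : R) : 0 <= a -> b <= 1 -> t \in `[a, b] -> t \in `[0, 1].
Proof. by rewrite !in_itv /= => ? ? /andP[? ?]; apply/andP; split; lra. Qed.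

Lemma head_vertex e z v : head e z -> z = p v -> v = src e.
Proof.
move=> [t [eG t01] <-] /(arc_vertex eG) [] //; first by apply: half_sub t01; lra.
  by case.
by move: t01; rewrite in_itv /= => /andP[_ t12] [t1 _]; exfalso; lra.
Qed.

Lemma tail_vertex e z v : tail e z -> z = p v -> v = tgt e.
Proof.
move=> [t [eG t01] <-] /(arc_vertex eG) [] //; first by apply: half_sub t01; lra.
  by move: t01; rewrite in_itv /= => /andP[t12 _] [t0 _]; exfalso; lra.
by case.
Qed.

Lemma tails_meet e e' z : tail e z -> tail e' z -> tgt e = tgt e'.
Proof.
move=> [t [eG t01] <-] [t' [eG' t01'] E].
have [-> //|/eqP ne] := eqVneq e e'.
have l : (0 : R) <= 1 / 2 by lra.
have [] := arcs_meet eG eG' ne (half_sub l (lexx _) t01) (half_sub l (lexx _) t01') (esym E).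
move: t01 t01'; rewrite !in_itv /= => /andP[ht _] /andP[ht' _].
case=> t1; first by case: ((half_neq _).1 ht t1).
case=> t1'; first by case: ((half_neq _).1 ht' t1').
have [_ _ _ c1] := st eG; have [_ _ _ c1'] := st eG'; have [injp _ _ _] := pc.
by apply: injp; rewrite -c1 -c1' -{1}t1 -E t1'.
Qed.

Lemma heads_meet e e' z : head e z -> head e' z -> src e = src e'.
Proof.
move=> [t [eG t01] <-] [t' [eG' t01'] E].
have [-> //|/eqP ne] := eqVneq e e'.
have l : (1 / 2 : R) <= 1 by lra.
have [] := arcs_meet eG eG' ne (half_sub (lexx _) l t01) (half_sub (lexx _) l t01') (esym E).
move: t01 t01'; rewrite !in_itv /= => /andP[_ ht] /andP[_ ht'].
case=> t1; last by case: ((half_neq _).2 ht t1).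
case=> t1'; last by case: ((half_neq _).2 ht' t1').
have [_ _ c1 _] := st eG; have [_ _ c1' _] := st eG'; have [injp _ _ _] := pc.
by apply: injp; rewrite -c1 -c1' -{1}t1 -E t1'.
Qed.

Lemma head_tail_meet e e' z : e <> e' -> head e z -> tail e' z -> src e = tgt e'.
Proof.
move=> ne [t [eG t01] <-] [t' [eG' t01'] E].
have l : (1 / 2 : R) <= 1 by lra. have l' : (0 : R) <= 1 / 2 by lra.
have [] := arcs_meet eG eG' ne (half_sub (lexx _) l t01) (half_sub l' (lexx _) t01') (esym E).
move: t01 t01'; rewrite !in_itv /= => /andP[_ ht] /andP[ht' _].
case=> t1; last by case: ((half_neq _).2 ht t1).
case=> t1'; first by case: ((half_neq _).1 ht' t1').
have [_ _ c0 _] := st eG; have [_ _ _ c1'] := st eG'; have [injp _ _ _] := pc.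
by apply: injp; rewrite -c0 -c1' -{1}t1 -E t1'.
Qed.

Definition piece (i : G + {set G} + {set G}) : set (R * R) :=
  match i with inl (inl v) => [set p v] | inl (inr e) => head e | inr e => tail e end.

Lemma piece_compact i : compact (piece i).
Proof.
case: i => [[v|e]|e] /=; first exact: compact_set1.
  by apply: arc_compact; lra.
by apply: arc_compact; lra.
Qed.

Lemma pieces_separated : exists2 d : R, 0 < d & forall i j,
  (forall z, piece i z -> ~ piece j z) -> forall z z', piece i z -> piece j z' -> ~ close d z z'.
Proof.
have /boolp.choice[d dP] : forall ij : (G + {set G} + {set G}) * (G + {set G} + {set G}),
    exists d : R, 0 < d /\ ((forall z, piece ij.1 z -> ~ piece ij.2 z) ->
      forall z z', piece ij.1 z -> piece ij.2 z' -> ~ close d z z').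
  move=> [i j] /=; have [dij|ndij] := pselect (forall z, piece i z -> ~ piece j z).
    by have [d d0 dP] := compact_separated (@piece_compact i) (@piece_compact j) dij; exists d.
  by exists 1.
exists (\big[Num.min/1]_ij d ij).
  by apply: (big_ind (fun x => 0 < x)) => // [x y x0 y0|ij _]; [rewrite lt_min x0 y0|have [] := dP ij].
move=> i j dij z z' iz jz' [c1 c2]; have [_ /(_ dij z z' iz jz')] := dP (i, j); apply.
by split; [apply: lt_le_trans c1 _|apply: lt_le_trans c2 _]; exact: (bigmin_le _ (i, j)).
Qed.

Lemma pieces_box : exists M : R, forall i z, piece i z -> inbox M z.
Proof.
have /boolp.choice[m mP] i := compact_box (@piece_compact i).
exists (\big[Num.max/0]_i m i) => i z /mP[z1 z2].
have le : m i <= \big[Num.max/0]_i m i by exact: (le_bigmax _ _ i).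
by split; [apply: le_trans z1 le|apply: le_trans z2 le].
Qed.

Section Fibers.
Variables M h : R.
Hypothesis h_gt0 : 0 < h.
Hypothesis boxM : forall i z, piece i z -> inbox M z.
Hypothesis sepP : forall i j, (forall z, piece i z -> ~ piece j z) ->
  forall z z', piece i z -> piece j z' -> ~ close (3 * h) z z'.

Let Cn i := corners M h (piece i).

Lemma corners_disjoint i j g : (forall z, piece i z -> ~ piece j z) -> Cn i g -> ~ Cn j g.
Proof.
move=> dij [z iz zg] [z' jz' zg'].
exact: (sepP dij iz jz' (corner_close h_gt0 (boxM iz) (boxM jz') zg zg')).
Qed.

(** The half of an edge next to its target is given entirely to the target. *)
Definition core (v : G) (g : nat * nat) : Prop :=
  Cn (inl (inl v)) g \/ exists2 e, tgt e = v & Cn (inr e) g.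

(** Around the midpoint, corners of the head also belong to the core of the target. The source only
    receives what its own corners reach along the head without entering that core. *)
Definition reach (e : {set G}) (g : nat * nat) : Prop :=
  exists2 g1, Cn (inl (inl (src e))) g1 &
    gconn (fun x => Cn (inl (inr e)) x /\ ~ core (tgt e) x) g1 g.

Definition fiber (v : G) (g : nat * nat) : Prop :=
  core v g \/ exists e, [/\ e \in edges G, src e = v & reach e g].

Lemma reach_head e g : reach e g -> Cn (inl (inr e)) g /\ ~ core (tgt e) g.
Proof. by move=> [g1 _ hg]; have [] := gconn_end hg. Qed.

Lemma core_inj u v g : core u g -> core v g -> u = v.
Proof.
move=> hu hv; apply: contrapT => nuv; have [injp _ _ _] := pc.
case: hu hv => [hu|[e te hu]] [hv|[e' te' hv]].
- by apply: corners_disjoint hu hv => z /= -> /injp.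
- by apply: corners_disjoint hu hv => z /= zu /tail_vertex/(_ zu) uE; apply: nuv; rewrite uE.
- by apply: corners_disjoint hv hu => z /= zu /tail_vertex/(_ zu) uE; apply: nuv; rewrite uE.
- apply: corners_disjoint hu hv => z /= hz hz'; apply: nuv.
  by rewrite -te -te'; apply: tails_meet hz hz'.
Qed.

Lemma head_core e v g : Cn (inl (inr e)) g -> core v g -> v = src e \/ v = tgt e.
Proof.
move=> he hv; apply: contrapT => /not_orP[ns nt].
case: hv => [hv|[e' te' hv]].
  by apply: corners_disjoint he hv => z /= hz zv; apply: ns; apply: head_vertex hz zv.
apply: corners_disjoint he hv => z /= hz hz'; apply: ns; rewrite -te'.
apply/esym/(head_tail_meet _ hz hz') => ee'; apply: nt; by rewrite ee' te'.
Qed.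

(** A head shares corners only with the cores of its own two ends, and [reach] excludes the core of
    the target. Heads with different sources are disjoint, hence share no corner. *)
Lemma fiber_inj u v g : fiber u g -> fiber v g -> u = v.
Proof.
have aux w e : core w g -> e \in edges G -> reach e g -> w = src e.
  by move=> wg eG /reach_head[he nt]; have [//|wE] := head_core he wg; case: nt; rewrite -wE.
move=> [hu|[e [eG su hu]]] [hv|[e' [eG' sv hv]]].
- exact: core_inj hu hv.
- by rewrite -sv; apply: aux hv.
- by rewrite -su; apply/esym/(aux _ _ hv).
- apply: contrapT => nuv; have [hu' _] := reach_head hu; have [hv' _] := reach_head hv.
  apply: corners_disjoint hu' hv' => z /= hz hz'; apply: nuv.
  by rewrite -su -sv; apply: heads_meet hz hz'.
Qed.

Let n := (Num.truncn ((2 * M + h) / h)).+1.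

Lemma fiber_box u g : fiber u g -> (0 < g.1 <= n)%N /\ (0 < g.2 <= n)%N.
Proof.
have aux i : Cn i g -> (0 < g.1 <= n)%N /\ (0 < g.2 <= n)%N.
  by move=> [z /boxM iz zg]; apply: corner_box iz zg.
by case=> [[/aux//|[e _ /aux//]]|[e [_ _ /reach_head[/aux]]]].
Qed.

Lemma arc_conn (P : nat * nat -> Prop) e (a b : R) (i : G + {set G} + {set G}) :
  e \in edges G -> 0 <= a -> b <= 1 -> piece i = arc e a b -> (forall g, Cn i g -> P g) ->
  forall t u x y, t \in `[a, b] -> u \in `[a, b] ->
    corner M h (c e t) x -> corner M h (c e u) y -> gconn P x y.
Proof.
move=> eG a0 b1 iE iP; have [_ /(_ e eG)[ce _ _] _ _] := pc.
have inP t : t \in `[a, b] -> piece i (c e t) by rewrite iE => tab; exists t.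
apply: (corners_path_conn h_gt0).
- apply: continuous_subspaceW ce => t /=; rewrite !in_itv /= => /andP[? ?].
  by apply/andP; split; [exact: le_trans a0 _|exact: le_trans _ b1].
- by move=> t /inP/boxM.
- by move=> t g /inP it tg; apply: iP; exists (c e t).
Qed.

Lemma fiber_conn u x y : fiber u x -> fiber u y -> gconn (fiber u) x y.
Proof.
have l0 : (0 : R) <= 1 / 2 by rewrite divr_ge0.
have l1 : (1 / 2 : R) <= 1 by rewrite ler_pdivrMr // mul1r ler1n.
have base g g' : Cn (inl (inl u)) g -> Cn (inl (inl u)) g' -> gconn (fiber u) g g'.
  move=> [z /= -> zg] [z' /= -> zg']; apply: corner_conn zg zg' => k hk.
  by left; left; exists (p u).
suff all g : fiber u g -> gconn (fiber u) (cell M h (p u)) g.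
  by move=> /all/gconn_sym ux /all; apply: gconn_trans.
have bcell : Cn (inl (inl u)) (cell M h (p u)) by exists (p u) => //; exact: corner_cell.
case=> [[ug|[e te [z [t [eG t01] <-] zg]]]|[e [eG se [g1 ug1 conn]]]].
- exact: base.
- have [_ _ _ c1] := st eG.
  apply: (@arc_conn _ e (1 / 2) 1 (inr e) eG l0 (lexx _) erefl _ 1 t) => //.
  + by move=> k hk; left; right; exists e.
  + by rewrite in_itv /= l1 lexx.
  + by rewrite c1 te; apply: corner_cell.
- rewrite se in ug1; apply: gconn_trans (base _ _ bcell ug1) _.
  apply: gconn_mono (gconn_reach conn) => k hk; right; exists e; split=> //.
  by exists g1 => //; rewrite se.
Qed.

(** The corners of the head connect the cell of the source to the cell of the midpoint, which lies
    in the core of the target through the tail. The first entry into this core is the crossing. *)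
Lemma edge_crossing e : e \in edges G ->
  exists z z', [/\ fiber (src e) z, gadj z z' & fiber (tgt e) z'].
Proof.
move=> eG; have [_ nst c0 c1] := st eG.
have l0 : (0 : R) <= 1 / 2 by rewrite divr_ge0.
have l1 : (1 / 2 : R) <= 1 by rewrite ler_pdivrMr // mul1r ler1n.
have in0 : (0 : R) \in `[0, 1 / 2] by rewrite in_itv /= lexx.
have inh : (1 / 2 : R) \in `[0, 1 / 2] by rewrite in_itv /= l0 lexx.
have bs : Cn (inl (inl (src e))) (cell M h (p (src e))).
  by exists (p (src e)) => //; exact: corner_cell.
have conn : gconn (Cn (inl (inr e))) (cell M h (p (src e))) (cell M h (c e (1 / 2))).
  apply: (@arc_conn _ e 0 (1 / 2) (inl (inr e)) eG (lexx _) l1 erefl _ 0 (1 / 2)) => //.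
    by rewrite c0; apply: corner_cell.
  exact: corner_cell.
have nQ : ~ core (tgt e) (cell M h (p (src e))).
  by move=> ct; case/eqP: nst; apply: core_inj ct; left.
have Qh : core (tgt e) (cell M h (c e (1 / 2))).
  right; exists e => //; exists (c e (1 / 2)); last exact: corner_cell.
  by exists (1 / 2) => //; split=> //; rewrite in_itv /= lexx l1.
have [z [z' [sz zz' tz']]] := gconn_first_hit conn nQ Qh.
exists z, z'; split=> //; last by left.
by right; exists e; split=> //; exists (cell M h (p (src e))).
Qed.

Lemma fiber_bound : critical 4 G -> (2 * #|edges G| <= 5 * #|G|)%N.
Proof.
have /boolp.choice[r rP] : forall e, exists rst : gedge * (G * G), e \in edges G ->
    [/\ e = [set rst.2.1; rst.2.2]%SET, fiber rst.2.1 (gend1 rst.1) & fiber rst.2.2 (gend2 rst.1)].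
  move=> e; have [eG|_] := boolP (e \in edges G); last by exists ((true, (0, 0)%N), (g0, g0)).
  have [eE _ _ _] := st eG; have [z [z' [sz [k kE] tz']]] := edge_crossing eG.
  (* The grid edge may point against the orientation of [e]; the roles of source and target are then
     exchanged. *)
  case: kE => -[zE z'E]; rewrite zE in sz; rewrite z'E in tz'.
    by exists (k, (src e, tgt e)).
  by exists (k, (tgt e, src e)) => _; split=> //=; rewrite finset.setUC.
exact: (@grid_minor_bound G n fiber fiber_inj fiber_box fiber_conn (fun e => (r e).1)
  (fun e => (r e).2.1) (fun e => (r e).2.2) rP).
Qed.

End Fibers.

End Drawing.

Lemma planar_critical4_bound (R : realType) (G : sgraph) :
  planar4critical R G -> (2 * #|edges G| <= 5 * #|G|)%N.
Proof.
move=> [cG [p [c pc]]].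
have [g0 _|noG] := pickP (fun _ : G => true); last first.
  case/negP: (critical4_nocolor cG); apply/colorableP.
  by exists (fun=> ord0) => x; have := noG x.
have [src [tgt st]] := drawing_ends g0 pc.
have [d d0 dP] := pieces_separated pc.
have [M MP] := pieces_box pc.
(* Points with a common corner are closer than [3 * h], so with mesh [d / 3] disjoint pieces have no
   common corner. *)
have h0 : (0 < d / 3)%R by rewrite divr_gt0.
apply: (fiber_bound g0 pc st h0 MP _ cG).
by move=> i j /dP sep z z' iz jz'; rewrite mulrC divfK //; apply: sep.
Qed.

(** * The dense critical graphs *)

Section Construction.
Variable n : nat.

(* [(true, (i, j))] and [(false, (i, j))] stand for the vertices [x_ij] and
   [y_ij]; the last two cases below are the two long edges. *)
Definition arrow (u v : bool * (nat * nat)) : bool :=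
  let: (a, (i, j)) := u in let: (b, (k, l)) := v in
  match a, b with
  | true, true => ((k == i.+1) && (l == j)) || [&& i == 0, k == 0, j == 0 & l == n.+2]
  | false, true => ((k == i) || (k == i.+1)) && ((l == j) || (l == j.+1))
  | false, false => [&& i == 0, j == n.+2, k == n.+1 & l == n.+2]
  | true, false => false
  end%N.

Lemma arrow_asym u v : arrow u v -> arrow v u -> False.
Proof. by case: u => [[] [i j]]; case: v => [[] [k l]] //=; lia. Qed.

Definition patch_vertex := (bool * ('I_n.+3 * 'I_n.+3))%type.
Definition to_nat (u : patch_vertex) : bool * (nat * nat) := (u.1, (u.2.1 : nat, u.2.2 : nat)).

Lemma to_nat_inj : injective to_nat.
Proof.
move=> [a [i j]] [b [k l]] [-> ik jl]; congr (_, (_, _)); exact: val_inj.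
Qed.

Definition patch_adj : rel patch_vertex := fun u v => arrow (to_nat u) (to_nat v) || arrow (to_nat v) (to_nat u).

Lemma patch_adj_sym : symmetric patch_adj.
Proof. by move=> u v; rewrite /patch_adj orbC. Qed.

Lemma patch_adj_irr : irreflexive patch_adj.
Proof.
by move=> u; rewrite /patch_adj orbb; apply/negP => h; exact: (arrow_asym h h).
Qed.

Definition patch : sgraph := SGraph patch_adj_sym patch_adj_irr.

Lemma card_patch : #|patch| = (2 * (n.+3 * n.+3))%N.
Proof. by rewrite card_prod card_bool card_prod !card_ord. Qed.

Definition of_nat (u : bool * (nat * nat)) : patch_vertex := (u.1, (inord u.2.1, inord u.2.2)).

Lemma of_natK u : (u.2.1 <= n.+2)%N -> (u.2.2 <= n.+2)%N -> to_nat (of_nat u) = u.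
Proof. by case: u => a [i j] /= hi hj; rewrite /to_nat /= !inordK. Qed.

(** One long edge gives the ends of the first column of the [x_ij] different colours. This
    difference propagates through all columns and fixes one colour for all [y_ij] with [i <= n.+1],
    against the other long edge. *)
Lemma patch_not_colorable : ~~ colorable patch 3.
Proof.
apply/negP => /colorableP[f hf].
pose X i j := val (f (of_nat (true, (i, j)))); pose Y i j := val (f (of_nat (false, (i, j)))).
have X3 i j : (X i j < 3)%N by exact: ltn_ord.
have Y3 i j : (Y i j < 3)%N by exact: ltn_ord.
have col u v : arrow u v -> (u.2.1 <= n.+2)%N -> (u.2.2 <= n.+2)%N -> (v.2.1 <= n.+2)%N ->
    (v.2.2 <= n.+2)%N -> val (f (of_nat u)) <> val (f (of_nat v)).
  move=> uv *; apply/eqP; rewrite (inj_eq val_inj); apply: hf.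
  by rewrite /= /patch_adj !of_natK // uv.
have HX i j : (i <= n.+1)%N -> (j <= n.+2)%N -> X i j <> X i.+1 j.
  by move=> ? ?; apply: col => //=; lia.
have Y00 i j : (i <= n.+2)%N -> (j <= n.+2)%N -> Y i j <> X i j.
  by move=> ? ?; apply: col => //=; lia.
have Y10 i j : (i <= n.+1)%N -> (j <= n.+2)%N -> Y i j <> X i.+1 j.
  by move=> ? ?; apply: col => //=; lia.
have Y01 i j : (i <= n.+2)%N -> (j <= n.+1)%N -> Y i j <> X i j.+1.
  by move=> ? ?; apply: col => //=; lia.
have Y11 i j : (i <= n.+1)%N -> (j <= n.+1)%N -> Y i j <> X i.+1 j.+1.
  by move=> ? ?; apply: col => //=; lia.
have A : X 0 0 <> X 0 n.+2 by apply: col => //=; lia.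
have B : Y 0 n.+2 <> Y n.+1 n.+2 by apply: col => //=; lia.
have third a b c d : (a < 3)%N -> (b < 3)%N -> (c < 3)%N -> (d < 3)%N ->
    a <> b -> c <> a -> c <> b -> d <> a -> d <> b -> c = d.
  by case: a => [|[|[|a]]] //; case: b => [|[|[|b]]] //; case: c => [|[|[|c]]] //;
    case: d => [|[|[|d]]].
(* Both [y_ij] and [y_i(j+1)] avoid the two different colours of [x_i(j+1)] and [x_(i+1)(j+1)]. *)
have Ycol i j : (i <= n.+1)%N -> (j <= n.+2)%N -> Y i j = Y i 0.
  move=> hi; elim: j => // j IH hj; rewrite -IH; last lia.
  apply: (third (X i j.+1) (X i.+1 j.+1)) => //; by [apply: HX; lia|apply: Y00; lia|
    apply: Y10; lia|apply: Y01; lia|apply: Y11; lia].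
(* From one column to the next the bottom and top colours swap, and the [y] colour stays the third
   one. *)
have row i : (i <= n.+1)%N -> X i 0 <> X i n.+2 /\ Y i 0 = Y 0 0.
  elim: i => // i IH hi; have [Xi Yi] := IH (ltnW hi).
  have hi2 : (i <= n.+2)%N by apply: leqW; exact: ltnW.
  have yb := Y00 i n.+2 hi2 (leqnn _); rewrite Ycol ?(ltnW hi) // in yb.
  have yd := Y10 i n.+2 (ltnW hi) (leqnn _); rewrite Ycol ?(ltnW hi) // in yd.
  have ya := Y00 i 0 hi2 isT; have yc := Y10 i 0 (ltnW hi) isT.
  have ac := HX i 0 (ltnW hi) isT; have bd := HX i n.+2 (ltnW hi) (leqnn _).
  have cb : X i.+1 0 = X i n.+2 by apply: (third (X i 0) (Y i 0)) => //; apply: nesym.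
  have da : X i.+1 n.+2 = X i 0 by apply: (third (X i n.+2) (Y i 0)) => //; apply: nesym.
  split; first by rewrite cb da; apply: nesym.
  have y'c := Y00 i.+1 0 (leqW hi) isT; rewrite cb in y'c.
  have y'd := Y00 i.+1 n.+2 (leqW hi) (leqnn _); rewrite Ycol // da in y'd.
  by rewrite -Yi; apply: (third (X i 0) (X i n.+2)).
by apply: B; rewrite !Ycol //; have [_ ->] := row n.+1 (leqnn _).
Qed.

(* Colours of the [x_i*] and the [y_i*] when the only vertical wall is at the
   column [q] of the [x_ij]. *)
Definition xcol (q i : nat) : nat := if odd (i + q) then (if (i < q)%N then 0 else 1)%N else 2%N.
Definition ycol (q i : nat) : nat := if (i < q)%N then 1%N else 0%N.

Lemma xcol_lt3 q i : (xcol q i < 3)%N.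
Proof. by rewrite /xcol; case: (odd _) => //; case: (i < q)%N. Qed.

Lemma xcol_next q i : xcol q i != xcol q i.+1.
Proof.
by rewrite /xcol addSn /=; case: (odd _) => /=; case: (i < q)%N; case: (i.+1 < q)%N.
Qed.

(** Moving the wall by one changes the parity of [i + q], so exactly one of the two colours is 2. *)
Lemma xcol_shift q i : xcol q i != xcol q.+1 i.
Proof.
by rewrite /xcol addnS /=; case: (odd _) => /=; case: (i < q)%N; case: (i < q.+1)%N.
Qed.

(** Walls at the same column never conflict; with walls at [p] and [p + 1], only the centre [y_p]
    between them can. *)
Lemma xycol_eq (p i k : nat) (a b : bool) : (k == i) || (k == i.+1) ->
  ycol (p + b) i = xcol (p + a) k -> [/\ a <> b, i = p & k = (p + ~~ a)%N].
Proof.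
by rewrite /xcol /ycol => ki; case: a; case: b => /=;
  case: ifP; case: ifP => ?; rewrite ?ltnP; try case: ifP; move=> *; split; lia.
Qed.

(** * Colourings with a single monochromatic edge *)

Section Defect.
Variables (d : option (bool * bool)) (i j : nat).

(** The five edges at a position: [None] is the horizontal edge from [x_ij], and [Some (a, b)] is
    the edge from [y_ij] to a corner of its cell. *)
Definition defect_src : bool * (nat * nat) := if d is Some _ then (false, (i, j)) else (true, (i, j)).

Definition defect_tgt : bool * (nat * nat) :=
  if d is Some (a, b) then (true, (i + a, j + b))%N else (true, (i.+1, j)).

(** A true phase puts the vertical wall at column [i + 1], a false one at column [i]. For [None] the
    phase switches inside row [j], between [x_ij] and [x_(i+1)j], which both get colour 2. *)
Definition xphase (k l : nat) : bool :=
  if d is Some (a, b) then (l <= j)%N (+) (a (+) b) else (l < j)%N || ((l == j) && (i < k)%N).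

Definition yphase (l : nat) : bool :=
  if d is Some (a, b) then (if b then (l <= j)%N else (l < j)%N) (+) (a (+) b) else (l < j)%N.

(* The vertical wall moves between the columns [i] and [i + 1] where it crosses
   the horizontal one, so that only the deleted edge is monochromatic. *)
Definition wall_col (u : bool * (nat * nat)) : nat :=
  if u.1 then xcol (i + xphase u.2.1 u.2.2) u.2.1 else ycol (i + yphase u.2.2) u.2.1.

Lemma wall_col_lt3 u : (wall_col u < 3)%N.
Proof. by rewrite /wall_col; case: u.1; rewrite ?xcol_lt3 // /ycol; case: ifP. Qed.

Lemma wall_col_conflict u v : (0 < i <= n)%N -> (0 < j <= n.+1)%N -> arrow u v ->
  wall_col u = wall_col v -> u = defect_src /\ v = defect_tgt.
Proof.
move=> hi hj; case: u => [[] [i' j']]; case: v => [[] [k l]] //=; rewrite /wall_col /=.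
- case/orP => [/andP[/eqP-> /eqP->]|/and4P[/eqP-> /eqP-> /eqP-> /eqP->]].
    have [->|ne] := eqVneq (xphase i' j') (xphase i'.+1 j').
      by move/eqP; rewrite (negbTE (xcol_next _ _)).
    by move: ne; rewrite /xphase /defect_src /defect_tgt; case: d => [[a b]|]; rewrite ?eqxx // => ? _;
      split; congr (_, (_, _)); lia.
  (* The crossing lies strictly between rows [0] and [n.+2], so the ends of the left long edge see
     different walls. *)
  have : xphase 0 0 != xphase 0 n.+2.
    by rewrite /xphase; case: d => [[[] []]|]; lia.
  case: (xphase _ _); case: (xphase _ _) => // _; rewrite addn0 addn1 => /eqP.
    by rewrite eq_sym (negbTE (xcol_shift _ _)).
  by rewrite (negbTE (xcol_shift _ _)).
- move=> /andP[ki lj] /(xycol_eq ki)[ab i'E kE]; move: lj ab kE; rewrite i'E /xphase /yphase /defect_src /defect_tgt.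
  by case: d => [[[] []]|] lj ab kE; split; congr (_, (_, _)); move: lj ab kE; lia.
(* The vertical wall separates the ends of the top long edge, as [0 < i <= n]. *)
- move=> /and4P[/eqP-> /eqP-> /eqP-> /eqP->]; rewrite /ycol.
  by case: (yphase _); (case: ifP => ?; case: ifP => ?); lia.
Qed.

Lemma defect_arrow : arrow defect_src defect_tgt.
Proof.
by rewrite /defect_src /defect_tgt; case: d => [[[] []]|] /=; rewrite ?addn0 ?addn1 ?eqxx ?orbT.
Qed.

Lemma defect_colorable : (0 < i <= n)%N -> (0 < j <= n.+1)%N ->
  colorable (@del_edge patch [set of_nat defect_src; of_nat defect_tgt]%SET) 3.
Proof.
move=> hi hj; apply/colorableP.
exists (fun u : patch_vertex => Ordinal (wall_col_lt3 (to_nat u))) => u v.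
have aux (x y : patch_vertex) : arrow (to_nat x) (to_nat y) ->
    wall_col (to_nat x) = wall_col (to_nat y) -> x = of_nat defect_src /\ y = of_nat defect_tgt.
  move=> xy /(wall_col_conflict hi hj xy)[xs yt].
  by split; apply: to_nat_inj; rewrite ?xs ?yt of_natK //;
    rewrite /defect_src /defect_tgt; case: d => [[[] []]|] /=; lia.
move=> /andP[/orP[] uv ne]; apply: contraNneq ne => /(congr1 val) /= E.
  by have [-> ->] := aux _ _ uv E.
by have [-> ->] := aux _ _ uv (esym E); rewrite finset.setUC.
Qed.

End Defect.

(** Shifted by one, the indices range over [1..n] and [1..n.+1], where the two walls may cross. *)
Definition defect := (option (bool * bool) * ('I_n * 'I_n.+1))%type.

Definition defect_edge (x : defect) : {set patch} :=
  [set of_nat (defect_src x.1 x.2.1.+1 x.2.2.+1); of_nat (defect_tgt x.1 x.2.1.+1 x.2.2.+1)]%SET.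

Lemma defect_edge_in (x : defect) : defect_edge x \in edges patch.
Proof.
rewrite mem_edges /= /patch_adj !of_natK; first by rewrite defect_arrow.
all: have := ltn_ord x.2.1; have := ltn_ord x.2.2.
all: by rewrite /defect_src /defect_tgt; case: x.1 => [[[] []]|] /=; lia.
Qed.

(** As [arrow] is asymmetric, an edge determines its source and target, and these determine the
    defect. *)
Lemma defect_edge_inj : injective defect_edge.
Proof.
have rng (x : defect) : [/\ (defect_src x.1 x.2.1.+1 x.2.2.+1).2.1 <= n.+2, (defect_src x.1 x.2.1.+1 x.2.2.+1).2.2 <= n.+2,
    (defect_tgt x.1 x.2.1.+1 x.2.2.+1).2.1 <= n.+2 & (defect_tgt x.1 x.2.1.+1 x.2.2.+1).2.2 <= n.+2]%N.
  have := ltn_ord x.2.1; have := ltn_ord x.2.2.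
  by rewrite /defect_src /defect_tgt; case: x.1 => [[[] []]|] /= *; split; lia.
move=> x y exy; have [x1 x2 x3 x4] := rng x; have [y1 y2 y3 y4] := rng y.
have ax := defect_arrow x.1 x.2.1.+1 x.2.2.+1.
have ay := defect_arrow y.1 y.2.1.+1 y.2.2.+1.
have [es et] : defect_src x.1 x.2.1.+1 x.2.2.+1 = defect_src y.1 y.2.1.+1 y.2.2.+1 /\
    defect_tgt x.1 x.2.1.+1 x.2.2.+1 = defect_tgt y.1 y.2.1.+1 y.2.2.+1.
  have := set21 (of_nat (defect_src x.1 x.2.1.+1 x.2.2.+1)) (of_nat (defect_tgt x.1 x.2.1.+1 x.2.2.+1)).
  have := set22 (of_nat (defect_src x.1 x.2.1.+1 x.2.2.+1)) (of_nat (defect_tgt x.1 x.2.1.+1 x.2.2.+1)).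
  rewrite -/(defect_edge x) exy !inE => /orP[] /eqP/(congr1 to_nat) + /orP[] /eqP/(congr1 to_nat);
    rewrite !of_natK // => E1 E2.
  - by rewrite E1 E2 in ax; case: (arrow_asym ax ax).
  - by rewrite E1 E2 in ax; case: (arrow_asym ax ay).
  - by rewrite E1 E2 in ax; case: (arrow_asym ax ax).
case: x y es et {exy x1 x2 x3 x4 y1 y2 y3 y4 ax ay} => [d [i j]] [d' [i' j']] /=.
rewrite /defect_src /defect_tgt; case: d => [[a b]|]; case: d' => [[a' b']|] //= -[e1 e2] [e3 e4].
  have [ii jj] : i = i' /\ j = j' by split; apply: val_inj; case: e1; case: e2.
  by congr (Some (_, _), (_, _)) => //; move: e3 e4; rewrite ii jj; case: a; case: a';
    case: b; case: b' => /=; lia.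
by congr (_, (_, _)); apply: val_inj.
Qed.

Lemma card_defect_edges : #|[set defect_edge x | x : defect]%SET| = (5 * (n * n.+1))%N.
Proof.
rewrite card_imset; last exact: defect_edge_inj.
by rewrite card_prod card_option card_prod card_bool card_prod !card_ord.
Qed.

Lemma patch_critical_subgraph : exists E : {set {set patch}},
  critical 4 (subgraph E) /\ (5 * (n * n.+1) <= #|edges (subgraph E)|)%N.
Proof.
have [||E [sE cE]] := critical_subgraph (D := [set defect_edge x | x : defect]%SET) patch_not_colorable.
- by apply/fintype.subsetP => e /imsetP[x _ ->]; exact: defect_edge_in.
- move=> e /imsetP[x _ ->]; apply: defect_colorable; first by rewrite ltn_ord.
  by rewrite ltn_ord.
by exists E; split=> //; rewrite -card_defect_edges subset_leq_card.
Qed.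

End Construction.

(** * A plane drawing of the dense graphs *)

Section PatchDrawing.
Variables (R : realType) (n : nat).
Local Open Scope classical_set_scope.
Local Open Scope ring_scope.
Local Notation nat_vertex := (bool * (nat * nat))%type.
Implicit Types (u v w : nat_vertex) (t : R).

(** Doubling the grid puts the centres [y_ij] at points with odd integer coordinates. *)
Definition pos u : R * R :=
  (2 * (u.2.1)%:R + (~~ u.1)%:R, 2 * (u.2.2)%:R + (~~ u.1)%:R).

(* The two long edges are bent to the left and to the top of the grid. *)
Definition bend u v : R * R :=
  (- [&& u.1, v.1 & v.2.1 == u.2.1]%:R, (~~ u.1 && ~~ v.1)%:R).

Definition curve u v t : R * R :=
  ((1 - t) * (pos u).1 + t * (pos v).1 + t * (1 - t) * (bend u v).1,
   (1 - t) * (pos u).2 + t * (pos v).2 + t * (1 - t) * (bend u v).2).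

Lemma curve0 u v : curve u v 0 = pos u.
Proof. by rewrite /curve !subr0 !mul1r !mul0r !addr0 -surjective_pairing. Qed.

Lemma curve1 u v : curve u v 1 = pos v.
Proof. by rewrite /curve !subrr !mul1r !mul0r !add0r !addr0 -surjective_pairing. Qed.

Lemma curve_continuous u v : continuous (curve u v).
Proof.
have aux (a b k : R) : continuous (fun t : R => (1 - t) * a + t * b + t * (1 - t) * k).
  move=> t; apply: cvgD; [apply: cvgD|]; apply: cvgM; try exact: cvg_cst; try exact: cvg_id.
    by apply: cvgB; [exact: cvg_cst|exact: cvg_id].
  by apply: cvgM; [exact: cvg_id|apply: cvgB; [exact: cvg_cst|exact: cvg_id]].
move=> t; apply: (@cvg_pair _ _ _ _ (nbhs (curve u v t).1) (nbhs (curve u v t).2)).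
  exact: (aux (pos u).1 (pos v).1 (bend u v).1 t).
exact: (aux (pos u).2 (pos v).2 (bend u v).2 t).
Qed.

Inductive arrow_spec u v : Prop :=
| ArrowH i j of u = (true, (i, j)) & v = (true, (i.+1, j))
| ArrowD i j (a b : bool) of u = (false, (i, j)) & v = (true, (i + a, j + b))%N
| ArrowL of u = (true, (0, 0))%N & v = (true, (0, n.+2))%N
| ArrowT of u = (false, (0, n.+2))%N & v = (false, (n.+1, n.+2))%N.

Lemma arrowP u v : arrow n u v -> arrow_spec u v.
Proof.
case: u => [[] [i j]]; case: v => [[] [k l]] //=.
- case/orP => [/andP[/eqP-> /eqP->]|/and4P[/eqP-> /eqP-> /eqP-> /eqP->]].
    by apply: (ArrowH (i := i) (j := j)).
  exact: ArrowL.
- move=> /andP[ki lj]; apply: (ArrowD (i := i) (j := j) (a := (k == i.+1)) (b := (l == j.+1))) => //.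
  by congr (_, (_, _)); [move: ki|move: lj] => /orP[] /eqP ->; rewrite ?eqxx ?addn1 //;
     rewrite ltn_eqF ?addn0.
- by move=> /and4P[/eqP-> /eqP-> /eqP-> /eqP->]; exact: ArrowT.
Qed.

Lemma nat_gap (a b : nat) t : 0 < t < 1 -> a%:R + t <> b%:R :> R.
Proof.
move=> /andP[t0 t1] E.
have : (a%:R < b%:R :> R) && (b%:R < a.+1%:R :> R) by rewrite -natr1 -E; apply/andP; split; lra.
by rewrite !ltr_nat => /andP[ab]; rewrite ltnS leqNgt ab.
Qed.

Lemma nat_unit_eq (a b : nat) : a%:R < b%:R + 1 :> R -> b%:R < a%:R + 1 :> R -> a = b.
Proof. by rewrite !natr1 !ltr_nat !ltnS => h1 h2; apply/eqP; rewrite eqn_leq h1. Qed.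

(** The coordinate lies strictly between [2 i] and [2 i + 2], and its side of the midpoint reveals
    [a]. *)
Lemma diagonal_eq (i k : nat) (a b : bool) t (t' : R) : 0 < t < 1 -> 0 < t' < 1 ->
  2 * i%:R + 1 + (2 * a%:R - 1) * t = 2 * k%:R + 1 + (2 * b%:R - 1) * t' -> i = k /\ a = b.
Proof.
move=> /andP[t0 t1] /andP[t0' t1'] E.
have ik : i = k by apply: nat_unit_eq; move: E; case: a; case: b => /=; lra.
by split=> //; move: E; rewrite ik; case: a; case: b => //=; lra.
Qed.

Lemma diagonal_even (i k : nat) (a : bool) t : 0 < t < 1 ->
  2 * i%:R + 1 + (2 * a%:R - 1) * t <> 2 * k%:R.
Proof.
move=> /andP[t0 t1] E; apply: (@nat_gap (2 * i + a)%N (2 * k)%N (if a then t else 1 - t)).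
  by case: (a); apply/andP; split; lra.
by rewrite !natrD; move: E; case: a => /=; lra.
Qed.

Lemma diagonal_bounds (i : nat) (a : bool) t : 0 < t < 1 ->
  2 * i%:R <= 2 * i%:R + 1 + (2 * a%:R - 1) * t <= 2 * i%:R + 1 + a%:R.
Proof. by move=> /andP[t0 t1]; case: a => /=; apply/andP; split; lra. Qed.

Lemma curveH i j t : curve (true, (i, j)) (true, (i.+1, j)) t = (2 * i%:R + 2 * t, 2 * j%:R).
Proof.
rewrite /curve /pos /bend /= gtn_eqF // -natr1.
by congr (_, _); rewrite !mulr0n /=; ring.
Qed.

Lemma curveD i j (a b : bool) t : curve (false, (i, j)) (true, (i + a, j + b)%N) t =
  (2 * i%:R + 1 + (2 * a%:R - 1) * t, 2 * j%:R + 1 + (2 * b%:R - 1) * t).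
Proof.
rewrite /curve /pos /bend /= !natrD; congr (_, _); rewrite ?mulr0n ?mulr1n; ring.
Qed.

Lemma curveL t : curve (true, (0, 0)%N) (true, (0, n.+2)%N) t =
  (- (t * (1 - t)), 2 * (n.+2)%:R * t).
Proof.
rewrite /curve /pos /bend /=; congr (_, _); rewrite ?eqxx ?mulr0n ?mulr1n; ring.
Qed.

Lemma curveT t : curve (false, (0, n.+2)%N) (false, (n.+1, n.+2)%N) t =
  (1 + 2 * (n.+1)%:R * t, 2 * (n.+2)%:R + 1 + t * (1 - t)).
Proof.
rewrite /curve /pos /bend /=; congr (_, _); rewrite ?eqxx ?mulr0n ?mulr1n; ring.
Qed.

(** Inside a diagonal no coordinate is an integer; a horizontal edge runs in an even row between
    consecutive even abscissae; the long edges bulge out to the left and above all vertices. *)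
Lemma curve_vertex u v w t : arrow n u v -> (w.2.2 <= n.+2)%N ->
  0 < t < 1 -> curve u v t <> pos w.
Proof.
move=> /arrowP uv wn t01; have /andP[t0 t1] := t01; rewrite /pos.
set d := ~~ w.1; set k := w.2.1 in wn *; set l := w.2.2 in wn *.
have tt : 0 < t * (1 - t) by rewrite mulr_gt0 // subr_gt0.
have kge : 0 <= k%:R :> R by [].
have dge : 0 <= d%:R :> R by [].
case: uv => [i j|i j a b||] -> ->.
- rewrite curveH => -[E1 E2].
  have d0 : d = false.
    apply/negbTE/negP => dT; have : ((2 * j)%:R = (2 * l + 1)%:R :> R).
      by rewrite natrD !natrM E2 dT.
    by move/eqP; rewrite eqr_nat; lia.
  apply: (@nat_gap i k t t01); move: E1; rewrite d0 /=; lra.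
- rewrite curveD; case: a => -[E1 E2].
    apply: (@nat_gap (2 * i + 1)%N (2 * k + d)%N t t01).
    by rewrite !natrD; move: E1 => /=; lra.
  apply: (@nat_gap (2 * i)%N (2 * k + d)%N (1 - t)); first by apply/andP; split; lra.
  by rewrite !natrD; move: E1 => /=; lra.
- by rewrite curveL => -[E1 _]; lra.
- rewrite curveT => -[_ E2].
  have : (l%:R <= n.+2%:R :> R) by rewrite ler_nat.
  have : (d%:R <= 1 :> R) by case: (d); rewrite ?lexx.
  by lra.
Qed.

Lemma curve_inj u v (t t' : R) : arrow n u v -> curve u v t = curve u v t' ->
  0 <= t <= 1 -> 0 <= t' <= 1 -> t = t'.
Proof.
move=> /arrowP[i j|i j a b||] -> ->.
- by rewrite !curveH => -[E1] _ _; lra.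
- by rewrite !curveD => -[E1 _] _ _; move: E1; case: a => /= E1; lra.
- rewrite !curveL => -[_ /mulfI E] _ _; apply: E.
  by rewrite mulf_neq0 // pnatr_eq0.
- rewrite !curveT => -[/addrI/mulfI E] _ _ _; apply: E.
  by rewrite mulf_neq0 // pnatr_eq0.
Qed.

(** Diagonals are told apart by their coordinates and avoid the even rows of the horizontal edges.
    The left long edge has negative abscissa, the top one has positive abscissa and lies above all
    short edges. *)
Lemma curve_cross u v u' v' (t t' : R) : arrow n u v -> arrow n u' v' ->
  (u.2.2 <= n.+2)%N -> (v.2.2 <= n.+2)%N -> (u'.2.2 <= n.+2)%N -> (v'.2.2 <= n.+2)%N ->
  0 < t < 1 -> 0 < t' < 1 -> curve u v t = curve u' v' t' -> u = u' /\ v = v'.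
Proof.
move=> uv uv' un vn un' vn' t01 t01'; have /andP[t0 t1] := t01; have /andP[t0' t1'] := t01'.
have tt : 0 < t * (1 - t) by rewrite mulr_gt0 // subr_gt0.
have tt' : 0 < t' * (1 - t') by rewrite mulr_gt0 // subr_gt0.
have le (x : nat) : (x <= n.+2)%N -> 2 * x%:R <= 2 * n.+2%:R :> R.
  by move=> xn; rewrite ler_pM2l // ler_nat.
have leD (x : nat) (b : bool) : (x + b <= n.+2)%N -> 2 * x%:R + 1 + b%:R <= 2 * n.+2%:R + 1 :> R.
  move=> xn; have := le _ xn; rewrite natrD; case: b {xn} => /=; lra.
have ge (x : nat) : 0 <= 2 * x%:R :> R by rewrite mulr_ge0.
have ge1 (x : nat) (s : R) : 0 < s < 1 -> 0 < 1 + 2 * x%:R * s.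
  by move=> /andP[s0 _]; rewrite ltr_pwDl // mulr_ge0 // ltW.
have ltN (s : R) : 0 < s < 1 -> 2 * n.+2%:R * s < 2 * n.+2%:R + 1.
  move=> /andP[_ s1]; apply: (@le_lt_trans _ _ (2 * n.+2%:R)); last by rewrite ltrDl.
  by rewrite ler_piMr // ltW.
clear t0 t1 t0' t1'.
case: (arrowP uv) (arrowP uv') un vn un' vn' =>
  [i j|i j a b||] -> -> [i' j'|i' j' a' b'||] -> -> /= un vn un' vn';
  rewrite ?(curveH, curveD, curveL, curveT) => -[E1 E2] //.
- have jj : j = j' by apply/eqP; move: E2 => /mulfI/eqP; rewrite eqr_nat; apply.
  have /andP[? ?] := t01; have /andP[? ?] := t01'.
  have ii : i = i' by apply: nat_unit_eq; move: E1; lra.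
  by rewrite ii jj.
- by case: (diagonal_even t01' (esym E2)).
- by exfalso; have := ge i; have /andP[? ?] := t01; move: E1 tt'; lra.
- by exfalso; have := le _ un; move: E2 tt'; lra.
- by case: (diagonal_even t01 E2).
- have [-> ->] := diagonal_eq t01 t01' E1.
  by have [-> ->] := diagonal_eq t01 t01' E2.
- by exfalso; have := ge i; have /andP[+ _] := diagonal_bounds i a t01; rewrite E1; move: tt'; lra.
- by exfalso; have := leD _ _ vn; have /andP[_] := diagonal_bounds j b t01; rewrite E2; move: tt'; lra.
- by exfalso; have := ge i'; have /andP[? ?] := t01'; move: E1 tt; lra.
- by exfalso; have := ge i'; have /andP[+ _] := diagonal_bounds i' a' t01'; rewrite -E1; move: tt; lra.
- by exfalso; have := ge1 n.+1 t' t01'; move: E1 tt; lra.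
- by exfalso; have := le _ un'; move: E2 tt; lra.
- by exfalso; have := leD _ _ vn'; have /andP[_] := diagonal_bounds j' b' t01'; rewrite -E2; move: tt; lra.
- by exfalso; have := ge1 n.+1 t t01; move: E1 tt'; lra.
Qed.

End PatchDrawing.

Section PatchPlanar.
Variables (R : realType) (n : nat).
Local Open Scope classical_set_scope.
Local Open Scope ring_scope.

Lemma pos_inj : injective (@pos R).
Proof.
move=> [a [i j]] [b [k l]] -[/= E1 E2].
have aux (x y : nat) (d d' : bool) : 2 * x%:R + d%:R = 2 * y%:R + d'%:R :> R -> d = d' /\ x = y.
  rewrite -!natrM -!natrD => /eqP; rewrite eqr_nat => /eqP.
  by case: d; case: d' => /= h; split=> //; lia.
have [/negb_inj ab ik] := aux _ _ _ _ E1; have [_ jl] := aux _ _ _ _ E2.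
by rewrite ab ik jl.
Qed.

Lemma patch_planar : planar R (patch n).
Proof.
have /boolp.choice[ori oriP] : forall e : {set patch n}, exists uv : patch_vertex n * patch_vertex n,
    e \in edges (patch n) -> arrow n (to_nat uv.1) (to_nat uv.2) /\ e = [set uv.1; uv.2]%SET.
  move=> e; have [/edgesP[x [y [/orP[] xy eE]]]|_] := boolP (e \in edges _).
  - by exists (x, y).
  - by exists (y, x); rewrite /= finset.setUC.
  - by exists ((true, (ord0, ord0)), (true, (ord0, ord0))).
have rng (u : patch_vertex n) : ((to_nat u).2.2 <= n.+2)%N by rewrite -ltnS ltn_ord.
exists (fun x : patch_vertex n => pos R (to_nat x)),
  (fun e (t : R) => curve (to_nat (ori e).1) (to_nat (ori e).2) t).
split.
- by move=> x y /pos_inj/to_nat_inj.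
- move=> e /oriP[uv eE]; split.
  + by apply: continuous_subspaceT => t; exact: curve_continuous.
  + by move=> t t'; rewrite !in_itv => h h' E; apply: curve_inj uv E h h'.
  + rewrite curve0 curve1 {3}eE; apply/seteqP; split=> z /=.
      by case=> ->; [exists (ori e).1|exists (ori e).2] => //; rewrite !inE eqxx ?orbT.
    by move=> [x]; rewrite !inE => /orP[] /eqP -> <-; [left|right].
- move=> e /oriP[uv eE] t; rewrite in_itv => t01 x; exact: (curve_vertex uv (rng x)).
- move=> e e' /oriP[uv eE] /oriP[uv' eE'] ne t t'; rewrite !in_itv /= => t01 /andP[t0' t1'].
  have [->|t'0] := eqVneq t' 0; first by rewrite curve0; apply: (curve_vertex uv (rng _)) t01.
  have [->|t'1] := eqVneq t' 1; first by rewrite curve1; apply: (curve_vertex uv (rng _)) t01.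
  have t01' : 0 < t' < 1 by rewrite !lt_neqAle t0' t1' eq_sym t'0 t'1.
  move=> /(curve_cross uv uv' (rng _) (rng _) (rng _) (rng _) t01 t01')[/to_nat_inj E1 /to_nat_inj E2].
  by apply: ne; rewrite eE eE' E1 E2.
Qed.

End PatchPlanar.

(** * Densities and the limit superior *)

Lemma dense_planar4critical (R : realType) (n : nat) : exists G : sgraph,
  [/\ planar4critical R G, #|G| = (2 * (n.+3 * n.+3))%N & (5 * (n * n.+1) <= #|edges G|)%N].
Proof.
have [E [cE sE]] := patch_critical_subgraph n.
exists (subgraph E); split=> //; first by split=> //; apply/planar_subgraph/patch_planar.
exact: card_patch.
Qed.

Lemma density_leq (R : realType) (G : sgraph) :
  planar4critical R G -> (density R G <= 5%:R / 2%:R)%R.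
Proof.
move=> /planar_critical4_bound h; rewrite /density.
(* Division by zero gives the value 0. *)
have [->|n0] := eqVneq #|G| 0; first by rewrite invr0 mulr0 divr_ge0.
rewrite ler_pdivrMr ?ltr0n ?lt0n // mulrAC ler_pdivlMr ?ltr0n //.
by rewrite -!natrM ler_nat mulnC.
Qed.

Theorem theorem1 (R : realType) :
  limsup_density R (planar4critical R) = (5%:R / 2%:R : R)%R%:E.
Proof.
apply/eqP; rewrite eq_le; apply/andP; split.
  apply: (@le_trans _ _ (ereal_sup [set r | exists G : sgraph,
     [/\ planar4critical R G, (1 <= #|G|)%N & r = (density R G)%:E]]%classic)).
    by apply: ereal_inf_lbound; exists 1%N.
  by apply: ge_ereal_sup => r [G [PG _ ->]]; rewrite lee_fin density_leq.
apply: le_ereal_inf_tmp => _ [N _ <-]; apply/lee_addgt0Pr => e e0.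
(* The deficit from 5/2 is [(25 n + 45) / (2 (n + 3)^2)]; it is at most [e] once [e (n + 3) >= 13],
   because [26 (n + 3) >= 25 n + 45]. *)
pose k := Num.truncn (13 / e)%R; pose n := (N + k)%N.
have [G [PG GE EG]] := dense_planar4critical R n.
apply: (@le_trans _ _ ((density R G)%:E + e%:E)%E); last first.
  apply: leeD2r; apply: ereal_sup_ubound; exists G; split=> //.
  by rewrite GE /n; lia.
rewrite -EFinD lee_fin /density GE.
set m : R := (n%:R)%R.
have m0 : (0 <= m)%R by rewrite /m.
have em : (13 <= e * (m + 3))%R.
  have : (13 / e < k.+1%:R)%R by rewrite truncnS_gt.
  rewrite ltr_pdivrMr // => h.
  have : (k%:R <= m)%R by rewrite /m ler_nat /n; lia.
  rewrite -natr1 in h; nra.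
have d0 : (0 < (2 * (n.+3 * n.+3))%:R :> R)%R by rewrite ltr0n.
rewrite -lerBlDr ler_pdivlMr //.
apply: (@le_trans _ _ ((5 * (n * n.+1))%:R)%R); last by rewrite ler_nat.
have n3 : (n.+3%:R = m + 3 :> R)%R by rewrite /m -natrD addn3.
have n1 : (n.+1%:R = m + 1 :> R)%R by rewrite /m natr1.
rewrite !natrM n3 n1 -/m.
have m3 : (0 <= m + 3)%R by lra.
have h2 := ler_wpM2r m3 em.
lra.
Qed.
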